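(* Let $A$ be a finite dimensional algebra over a field $k$ which is basic and indecomposable as an $A$-$A$-bimodule. Let $e\in A$ be an idempotent and $T$ the Okuyama-Rickard complex with respect to $e$. (a) $T$ is isomorphic to the right mutation $\mu^{-}_{eA}(A)$ of $A$ with respect to $eA$. (b) $T$ is a silting object in $\mathsf{K}^{\rm b}(\mathrm{proj}\text{-}A)$. (c) The following conditions are equivalent: (i) $T$ is a tilting object in $\mathsf{K}^{\rm b}(\mathrm{proj}\text{-}A)$. (ii) $\mathrm{Hom}_A(eA/eA(1-e)A,(1-e)A)=0$. (d) If $A$ is a self-injective algebra and $eA\simeq\nu(eA)$ holds, then $T$ is a tilting object in $\mathsf{K}^{\rm b}(\mathrm{proj}\text{-}A)$.
   Context: Modules are right modules; $\mathrm{proj}\text{-}A$ is the category of finitely generated projective right $A$-modules and $\mathcal{T}=\mathsf{K}^{\rm b}(\mathrm{proj}\text{-}A)$ the homotopy category of bounded complexes. $\nu=D\,\mathrm{Hom}_A(-,A)$ is the Nakayama functor, with $D=\mathrm{Hom}_k(-,k)$. For an $A$-module $X$, $P(X)$ denotes a projective cover of $X$. The Okuyama-Rickard complex with respect to $e$ is the complex $$T:=\bigl(P(eA(1-e)A)\xrightarrow{p_e}eA\bigr)\oplus(1-e)A,$$ where $P(eA(1-e)A)$ is in degree $0$, $eA$ is in degree $1$, $(1-e)A$ is a stalk complex in degree $0$, and $p_e$ is the composition of a projective cover of the submodule $eA(1-e)A$ of $eA$ with the inclusion into $eA$. An object $M\in\mathcal{T}$ is silting (respectively, tilting) if $\mathrm{Hom}_{\mathcal{T}}(M,M[i])=0$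 for all $i>0$ (respectively, all $i\neq0$) and the smallest thick subcategory of $\mathcal{T}$ containing $M$ is $\mathcal{T}$. In particular $A$ is a silting object. $\mathrm{add}\,M$ is the closure of $M$ under finite coproducts, summands and isomorphisms. Right mutation: for a basic silting object $M=X\oplus M'$, take a triangle $N\to D\xrightarrow{g}X\to N[1]$ where $g$ is a minimal right $\mathrm{add}\,M'$-approximation of $X$ (i.e. $D\in\mathrm{add}\,M'$, $\mathrm{Hom}_{\mathcal{T}}(D',g)$ is surjective for all $D'\in\mathrm{add}\,M'$, and any $h:D\to D$ with $gh=g$ is an isomorphism); then $\mu^-_X(M):=N\oplus M'$. Here $M=A=eA\oplus(1-e)A$ and $X=eA$. *)

(* Defs.v *)
From HB Require Import structures.
From mathcomp Require Import all_boot all_order all_algebra all_field.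
From mathcomp Require Import zify.

Set Implicit Arguments.
Unset Strict Implicit.
Unset Printing Implicit Defensive.

Import Order.TTheory GRing.Theory Num.Theory.
Local Open Scope ring_scope.

(* [ract M a] is the k-linear endomorphism x |-> x a of M. *)
Record rmod (k : fieldType) (A : falgType k) := RMod {
  rmod_sort :> vectType k;
  ract : A -> 'End(rmod_sort);
  ract_linear : linear ract;
  ract1 : forall x, ract 1 x = x;
  ractM : forall a b x, ract (a * b) x = ract b (ract a x)
}.

Section Modules.
Variables (k : fieldType) (A : falgType k).
Implicit Types (M N X Y : rmod A).

Definition rhom M N (f : 'Hom(M, N)) : Prop :=
  forall a x, f (ract M a x) = ract N a (f x).

Definition riso M N : Prop :=
  exists (f : 'Hom(M, N)) (g : 'Hom(N, M)),
    [/\ rhom f, rhom g, (g \o f)%VF = \1%VF & (f \o g)%VF = \1%VF].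

Lemma ractD M a b x : ract M (a + b) x = ract M a x + ract M b x.
Proof.
by have := ract_linear M 1 a b; rewrite !scale1r => ->; rewrite add_lfunE.
Qed.

Lemma rhom0 M N : rhom (0 : 'Hom(M, N)).
Proof. by move=> a x; rewrite !lfunE /= linear0. Qed.

Lemma rhom1 M : rhom (\1%VF : 'End(M)).
Proof. by move=> a x; rewrite !lfunE. Qed.

Lemma rhom_comp M N X (g : 'Hom(N, X)) (f : 'Hom(M, N)) :
  rhom g -> rhom f -> rhom (g \o f)%VF.
Proof. by move=> hg hf a x; rewrite !comp_lfunE hf hg. Qed.

Lemma rhomD M N (f g : 'Hom(M, N)) : rhom f -> rhom g -> rhom (f + g).
Proof. by move=> hf hg a x; rewrite !add_lfunE hf hg linearD. Qed.

Lemma rhomN M N (f : 'Hom(M, N)) : rhom f -> rhom (- f).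
Proof. by move=> hf a x; rewrite !opp_lfunE hf linearN. Qed.

Lemma rhomZ M N c (f : 'Hom(M, N)) : rhom f -> rhom (c *: f).
Proof. by move=> hf a x; rewrite !scale_lfunE hf linearZ. Qed.

Definition rzero : rmod A.
Proof.
refine (@RMod k A 'rV[k]_0 (fun _ => 0) _ _ _).
- by move=> c a b; rewrite scaler0 addr0.
- by move=> x; apply/rowP; case.
- by move=> a b x; apply/rowP; case.
Defined.

Section VectBiproduct.
Variables U V : vectType k.

Definition pr1 : 'Hom((U * V)%type, U) := linfun fst.
Definition pr2 : 'Hom((U * V)%type, V) := linfun snd.

Definition in1_fun (x : U) : (U * V)%type := (x, 0).
Definition in2_fun (y : V) : (U * V)%type := (0, y).

Fact in1_linear : linear in1_fun.
Proof. by move=> c x y; apply: injective_projections; rewrite /= ?scaler0 ?addr0. Qed.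
Fact in2_linear : linear in2_fun.
Proof. by move=> c x y; apply: injective_projections; rewrite /= ?scaler0 ?addr0. Qed.

HB.instance Definition _ := GRing.isSemilinear.Build k U (U * V)%type _
  in1_fun (GRing.semilinear_linear in1_linear).
HB.instance Definition _ := GRing.isSemilinear.Build k V (U * V)%type _
  in2_fun (GRing.semilinear_linear in2_linear).

Definition in1 : 'Hom(U, (U * V)%type) := linfun in1_fun.
Definition in2 : 'Hom(V, (U * V)%type) := linfun in2_fun.

Lemma pr1E p : pr1 p = p.1. Proof. by rewrite lfunE. Qed.
Lemma pr2E p : pr2 p = p.2. Proof. by rewrite lfunE. Qed.
Lemma in1E x : in1 x = (x, 0). Proof. by rewrite lfunE. Qed.
Lemma in2E y : in2 y = (0, y). Proof. by rewrite lfunE. Qed.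
End VectBiproduct.

Definition biprodE := (pr1E, pr2E, in1E, in2E).

Definition rsum M N : rmod A.
Proof.
refine (@RMod k A (M * N)%type
  (fun a => ((in1 M N \o ract M a \o pr1 M N) +
             (in2 M N \o ract N a \o pr2 M N))%VF)
  _ _ _).
- move=> c a b; apply/lfunP => p.
  rewrite (ract_linear M) (ract_linear N).
  rewrite !(add_lfunE, scale_lfunE, comp_lfunE) !biprodE.
  by apply: injective_projections; rewrite /= ?addr0 ?add0r.
- move=> [x y]; rewrite !(add_lfunE, comp_lfunE) !biprodE !ract1.
  by apply: injective_projections; rewrite /= ?addr0 ?add0r.
- move=> a b [x y]; rewrite !(add_lfunE, comp_lfunE) !biprodE !ractM /=.
  by apply: injective_projections; rewrite /= ?addr0 ?add0r.
Defined.

Lemma ract_sumE M N a (p : rsum M N) :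
  ract (rsum M N) a p = (ract M a p.1, ract N a p.2).
Proof.
rewrite /= !(add_lfunE, comp_lfunE) !biprodE.
by apply: injective_projections; rewrite /= ?addr0 ?add0r.
Qed.

Lemma rhom_pr1 M N : @rhom (rsum M N) M (pr1 M N).
Proof. by move=> a p; rewrite ract_sumE !biprodE. Qed.
Lemma rhom_pr2 M N : @rhom (rsum M N) N (pr2 M N).
Proof. by move=> a p; rewrite ract_sumE !biprodE. Qed.
Lemma rhom_in1 M N : @rhom M (rsum M N) (in1 M N).
Proof. by move=> a x; rewrite ract_sumE !biprodE /= linear0. Qed.
Lemma rhom_in2 M N : @rhom N (rsum M N) (in2 M N).
Proof. by move=> a x; rewrite ract_sumE !biprodE /= linear0. Qed.

Definition regmod : rmod A.
Proof.
refine (@RMod k A A (fun a => amulr a) _ _ _).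
- by move=> c a b; rewrite linearP.
- by move=> x; rewrite lfunE /= mulr1.
- by move=> a b x; rewrite !lfunE /= mulrA.
Defined.

Definition submodule M (U : {vspace M}) : Prop :=
  forall a x, x \in U -> ract M a x \in U.

Definition submod M (U : {vspace M}) (hU : submodule U) : rmod A.
Proof.
refine (@RMod k A (subvs_of U)
  (fun a => (linfun (@vsproj _ _ U) \o ract M a \o linfun (@vsval _ _ U))%VF)
  _ _ _).
- move=> c a b; rewrite (ract_linear M); apply/lfunP => x.
  by rewrite !(add_lfunE, scale_lfunE, comp_lfunE, lfunE) /= linearP.
- by move=> x; rewrite !(comp_lfunE, lfunE) /= ract1 vsvalK.
- move=> a b x; rewrite !(comp_lfunE, lfunE) /= ractM vsprojK //.
  exact/hU/subvsP.
Defined.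

Lemma val_ract_submod M (U : {vspace M}) (hU : submodule U) a (x : submod hU) :
  vsval (ract (submod hU) a x) = ract M a (vsval x).
Proof. by rewrite /= !(comp_lfunE, lfunE) /= vsprojK //; exact/hU/subvsP. Qed.

Lemma capCv M (U : {vspace M}) : (U^C :&: U)%VS = 0%VS.
Proof. by rewrite capvC capv_compl. Qed.

Lemma sub_daddv_piC M (U : {vspace M}) x : x - daddv_pi U^C U x \in U.
Proof.
have E : daddv_pi U^C U x + daddv_pi U U^C x = x.
  by apply: daddv_pi_add; rewrite ?capCv // addvC addv_complf memvf.
have -> : x - daddv_pi U^C U x = daddv_pi U U^C x.
  by apply/eqP; rewrite subr_eq addrC E.
exact: memv_pi.
Qed.

Lemma daddv_piC0 M (U : {vspace M}) x : x \in U -> daddv_pi U^C U x = 0.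
Proof.
move=> xU; apply/eqP; rewrite -memv0 -(capCv U) memv_cap memv_pi /=.
have /(memvB xU) := sub_daddv_piC U x.
by rewrite opprB addrCA subrr addr0.
Qed.

(* Each class of M/U is represented by its unique element in the complement
   U^C; [daddv_pi U^C U] is the projection onto U^C with kernel U. *)
Definition quotmod M (U : {vspace M}) (hU : submodule U) : rmod A.
Proof.
refine (@RMod k A (subvs_of U^C)
  (fun a => (linfun (@vsproj _ _ U^C) \o daddv_pi U^C U \o
             ract M a \o linfun (@vsval _ _ U^C))%VF) _ _ _).
- move=> c a b; rewrite (ract_linear M); apply/lfunP => x.
  by rewrite !(add_lfunE, scale_lfunE, comp_lfunE, lfunE) /= !linearP.
- move=> x; rewrite !(comp_lfunE, lfunE) /= ract1 daddv_pi_id ?vsvalK ?capCv //.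
  exact: subvsP.
- move=> a b x; rewrite !(comp_lfunE, lfunE) /= vsprojK ?memv_pi //.
  congr vsproj; rewrite ractM; apply/eqP; rewrite -subr_eq0 -!linearB /=.
  by apply/eqP/daddv_piC0/hU/sub_daddv_piC.
Defined.

Definition quotpi M (U : {vspace M}) (hU : submodule U) :
    'Hom(M, quotmod hU) :=
  (linfun (@vsproj _ _ U^C) \o daddv_pi U^C U)%VF.

Lemma val_quotpi M (U : {vspace M}) (hU : submodule U) x :
  vsval (quotpi hU x) = daddv_pi U^C U x.
Proof. by rewrite /quotpi comp_lfunE lfunE /= vsprojK ?memv_pi. Qed.

Lemma quotpi_rhom M (U : {vspace M}) (hU : submodule U) : rhom (quotpi hU).
Proof.
move=> a x; apply: val_inj; rewrite [LHS]val_quotpi.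
rewrite /= !(comp_lfunE, lfunE) /= !vsprojK ?memv_pi //.
apply/eqP; rewrite -subr_eq0 -!linearB /=.
by apply/eqP/daddv_piC0/hU/sub_daddv_piC.
Qed.

Lemma quotpi_surj M (U : {vspace M}) (hU : submodule U) :
  limg (quotpi hU) = fullv.
Proof.
apply/eqP; rewrite eqEsubv subvf /=; apply/subvP => x _; apply/memv_imgP.
exists (vsval x); first exact: memvf.
apply: val_inj; rewrite [RHS]val_quotpi daddv_pi_id ?capCv //.
exact: subvsP.
Qed.

Lemma quotpi_ker M (U : {vspace M}) (hU : submodule U) : lker (quotpi hU) = U.
Proof.
apply/vspaceP => x; rewrite memv_ker -val_eqE /= val_quotpi.
apply/eqP/idP => [x0|]; last exact: daddv_piC0.
by have := sub_daddv_piC U x; rewrite x0 subr0.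
Qed.

(* Projectivity and injectivity are those of the abelian category mod-A of
   finite dimensional modules. *)
Definition projective (P : rmod A) : Prop :=
  forall M N (g : 'Hom(M, N)) (f : 'Hom(P, N)),
    rhom g -> rhom f -> limg g = fullv ->
    exists2 h : 'Hom(P, M), rhom h & (g \o h)%VF = f.

Definition injective_mod (I : rmod A) : Prop :=
  forall M N (i : 'Hom(M, N)) (f : 'Hom(M, I)),
    rhom i -> rhom f -> lker i = 0%VS ->
    exists2 h : 'Hom(N, I), rhom h & (h \o i)%VF = f.

Definition self_injective : Prop := injective_mod regmod.

Record pmod := PMod { pmod_mod :> rmod A; pmod_projective : projective pmod_mod }.

Record projcover X := ProjCover {
  pc_mod :> pmod;
  pc_map : 'Hom(pc_mod, X);
  pc_rhom : rhom pc_map;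
  pc_surj : limg pc_map = fullv;
  pc_superfluous : forall U : {vspace pc_mod},
    submodule U -> (U + lker pc_map)%VS = fullv -> U = fullv
}.

Lemma rzero_projective : projective rzero.
Proof.
move=> M N g f _ _ _; exists 0; first exact: rhom0.
apply/lfunP => x; have -> : x = 0 by apply/rowP; case.
by rewrite !linear0.
Qed.

Lemma rsum_projective M N : projective M -> projective N -> projective (rsum M N).
Proof.
move=> pM pN X Y g f hg hf sg.
have [h1 hh1 e1] :=
  pM X Y g (f \o in1 M N)%VF hg (rhom_comp hf (@rhom_in1 M N)) sg.
have [h2 hh2 e2] :=
  pN X Y g (f \o in2 M N)%VF hg (rhom_comp hf (@rhom_in2 M N)) sg.
exists ((h1 \o pr1 M N) + (h2 \o pr2 M N))%VF.
  by apply: rhomD; apply: rhom_comp => //; [apply: rhom_pr1 | apply: rhom_pr2].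
apply/lfunP => -[x y].
rewrite comp_lfunE add_lfunE !comp_lfunE !biprodE linearD /= -!comp_lfunE.
rewrite e1 e2 !comp_lfunE !biprodE -linearD /=.
by congr (f _); apply: injective_projections; rewrite /= ?addr0 ?add0r.
Qed.

Lemma regmod_projective : projective regmod.
Proof.
move=> M N g f hg hf sg.
have /memv_imgP[m _ gm] : f (1 : A) \in limg g by rewrite sg memvf.
pose h0 (x : A) := ract M x m.
have h0_lin : linear h0.
  by move=> c x y; rewrite /h0 (ract_linear M) add_lfunE scale_lfunE.
pose hS := GRing.isSemilinear.Build k A M _ h0 (GRing.semilinear_linear h0_lin).
pose hL : {linear A -> M} := HB.pack h0 hS.
have hE x : (linfun hL : 'Hom(regmod, M)) x = ract M x m by rewrite lfunE.
have aE a (x : A) : ract regmod a x = x * a by rewrite /= lfunE.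
exists (linfun hL : 'Hom(regmod, M)).
  by move=> a x; rewrite !hE aE ractM.
by apply/lfunP => x; rewrite comp_lfunE hE hg -gm -hf aE mul1r.
Qed.

Definition pA : pmod := PMod regmod_projective.
Definition pzero : pmod := PMod rzero_projective.
Definition psum (P Q : pmod) : pmod :=
  PMod (@rsum_projective P Q (@pmod_projective P) (@pmod_projective Q)).

Lemma rideal_submodule (U : {vspace A}) :
  @submodule regmod (U * fullv)%VS.
Proof.
move=> a x xU; rewrite /= lfunE /=.
have : x * a \in (U * fullv * fullv)%VS by rewrite memv_mul ?memvf.
by rewrite -prodvA; apply: subvP; rewrite prodvS ?subvf ?subvv.
Qed.

(* The right ideal U A. *)
Definition rideal (U : {vspace A}) : rmod A := submod (@rideal_submodule U).

Section Idempotent.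
Variable e : A.

Definition eA : rmod A := rideal <[e]>.
Definition eAe'A_space : {vspace A} := (<[e]> * fullv * <[1 - e]> * fullv)%VS.
Definition eAe'A : rmod A := rideal (<[e]> * fullv * <[1 - e]>).

Lemma eAe'A_sub : (eAe'A_space <= <[e]> * fullv)%VS.
Proof. by rewrite /eAe'A_space -!prodvA prodvS ?subvf ?subvv. Qed.

Definition eAe'A_incl : 'Hom(eAe'A, eA) :=
  (linfun (@vsproj _ _ (<[e]> * fullv)%VS) \o linfun (@vsval _ _ eAe'A_space))%VF.

Lemma val_eAe'A_incl (x : eAe'A) : vsval (eAe'A_incl x) = vsval x.
Proof.
rewrite /eAe'A_incl comp_lfunE !lfunE /= vsprojK //.
by apply: (subvP eAe'A_sub); exact: subvsP.
Qed.

Lemma eAe'A_incl_rhom : rhom eAe'A_incl.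
Proof.
move=> a x; apply: val_inj; rewrite [LHS]val_eAe'A_incl.
rewrite [LHS]val_ract_submod; apply/esym; etransitivity.
  exact: val_ract_submod.
by rewrite val_eAe'A_incl.
Qed.

(* eA(1-e)A as a subspace of (the carrier of) eA *)
Definition eAe'A_in_eA : {vspace eA} :=
  (linfun (@vsval _ _ (<[e]> * fullv)%VS) @^-1: eAe'A_space)%VS.

Lemma eAe'A_in_eA_submodule : submodule eAe'A_in_eA.
Proof.
have E (y : eA) : (y \in eAe'A_in_eA) = (vsval y \in eAe'A_space).
  by rewrite -memv_preim lfunE.
move=> a x; rewrite !E => xU.
have -> : vsval (ract eA a x) = ract regmod a (vsval x).
  exact: val_ract_submod.
exact: rideal_submodule.
Qed.

Definition eA_mod_eAe'A : rmod A := quotmod eAe'A_in_eA_submodule.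

Lemma eA_mem x : x \in (<[e]> * fullv)%VS -> e * e = e -> e * x = x.
Proof.
have E y : y \in lker (amull e - \1%VF) = (e * y == y).
  by rewrite memv_ker add_lfunE opp_lfunE !lfunE /= subr_eq0.
move=> xU he; apply/eqP; rewrite -E; apply: subvP x xU.
apply/prodvP => u v /vlineP[c ->] _.
by rewrite E -scalerAl -scalerAr mulrA he.
Qed.

Lemma eA_projective : e * e = e -> projective eA.
Proof.
move=> he M N g f hg hf sg.
have eU : e \in (<[e]> * fullv)%VS.
  by have := memv_mul (memv_line e) (memvf (1 : A)); rewrite mulr1.
have /memv_imgP[m _ gm] : f (vsproj _ e) \in limg g by rewrite sg memvf.
pose h0 (x : eA) := ract M (vsval x) m.
have h0_lin : linear h0.
  move=> c x y; rewrite /h0 linearP /= (ract_linear M).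
  by rewrite add_lfunE scale_lfunE.
pose hS := GRing.isSemilinear.Build k eA M _ h0 (GRing.semilinear_linear h0_lin).
pose hL : {linear eA -> M} := HB.pack h0 hS.
have hE x : linfun hL x = ract M (vsval x) m by rewrite lfunE.
exists (linfun hL).
  by move=> a x; rewrite !hE val_ract_submod /= lfunE /= ractM.
apply/lfunP => x; rewrite comp_lfunE hE hg -gm -hf; congr (f _).
apply: val_inj; rewrite [LHS]val_ract_submod vsprojK // lfunE /=.
by apply: eA_mem => //; exact: subvsP.
Qed.

Lemma idem_compl : e * e = e -> (1 - e) * (1 - e) = 1 - e.
Proof. by move=> he; rewrite mulrBl mul1r mulrBr mulr1 he subrr subr0. Qed.

End Idempotent.

Definition peA (e : A) (he : e * e = e) : pmod := PMod (eA_projective he).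

Section Composition.
Variables U V W : vectType k.

Definition precomp (g : 'Hom(U, V)) (f : 'Hom(V, W)) : 'Hom(U, W) := (f \o g)%VF.
Definition postcomp (g : 'Hom(V, W)) (f : 'Hom(U, V)) : 'Hom(U, W) := (g \o f)%VF.

Fact precomp_linear g : linear (precomp g).
Proof. by move=> c f h; rewrite /precomp comp_lfunDl comp_lfunZl. Qed.
Fact postcomp_linear g : linear (postcomp g).
Proof. by move=> c f h; rewrite /postcomp comp_lfunDr comp_lfunZr. Qed.

HB.instance Definition _ g := GRing.isSemilinear.Build k 'Hom(V, W) 'Hom(U, W) _
  (precomp g) (GRing.semilinear_linear (precomp_linear g)).
HB.instance Definition _ g := GRing.isSemilinear.Build k 'Hom(U, V) 'Hom(U, W) _
  (postcomp g) (GRing.semilinear_linear (postcomp_linear g)).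
End Composition.

Section HomA.
Variable X : rmod A.

Definition rdefect (a : A) (f : 'Hom(X, A)) : 'Hom(X, A) :=
  ((f \o ract X a) - (amulr a \o f))%VF.

Fact rdefect_linear a : linear (rdefect a).
Proof.
move=> c f g; rewrite /rdefect comp_lfunDl comp_lfunDr -comp_lfunZl -comp_lfunZr.
by rewrite scalerBr opprD addrACA.
Qed.

HB.instance Definition _ a := GRing.isSemilinear.Build k 'Hom(X, A) 'Hom(X, A) _
  (rdefect a) (GRing.semilinear_linear (rdefect_linear a)).

(* The space Hom_A(X, A); testing A-linearity on a basis of A is enough, see
   [mem_homA]. *)
Definition homA : {vspace 'Hom(X, A)} :=
  (\bigcap_(i < \dim {:A}) lker (linfun (rdefect (vbasis {:A})`_i)))%VS.

Lemma mem_homA (f : 'Hom(X, A)) : f \in homA <-> @rhom X regmod f.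
Proof.
have defE a : rdefect a f = 0 <-> forall x, f (ract X a x) = f x * a.
  split=> [/lfunP h x|h].
    move: (h x); rewrite /rdefect add_lfunE opp_lfunE !comp_lfunE !lfunE /=.
    by move/eqP; rewrite subr_eq0 => /eqP.
  apply/lfunP => x; rewrite /rdefect add_lfunE opp_lfunE !comp_lfunE !lfunE /=.
  by rewrite h subrr.
have r0 : ract X 0 = 0.
  by have := ract_linear X (-1) 0 0; rewrite scaler0 addr0 scaleN1r addNr.
split=> [|hf]; last first.
  rewrite memvE; apply/subv_bigcapP => i _.
  rewrite -memvE memv_ker lfunE /=; apply/eqP/defE => x.
  by rewrite hf /= lfunE.
rewrite memvE => /subv_bigcapP hf a x; rewrite [RHS]/= lfunE /=.
rewrite (coord_vbasis (memvf a)).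
elim/big_rec: _ => [|i y _ IH]; first by rewrite r0 lfunE linear0 mulr0.
rewrite (ract_linear X) add_lfunE scale_lfunE linearP /= IH mulrDr -scalerAr.
congr (_ *: _ + _); move: x {IH}; apply/defE/eqP.
by have := hf i isT; rewrite -memvE memv_ker lfunE.
Qed.

(* The left action (a f)(x) = a f(x) on Hom_A(X, A). *)
Definition lact (a : A) : 'End(subvs_of homA) :=
  (linfun (@vsproj _ _ homA) \o
   linfun (@postcomp X A A (amull a)) \o
   linfun (@vsval _ _ homA))%VF.

Lemma val_lact a u : vsval (lact a u) = (amull a \o vsval u)%VF.
Proof.
rewrite /lact !(comp_lfunE, lfunE) /= vsprojK //.
have hu : @rhom X regmod (vsval u) by apply/mem_homA; exact: subvsP.
apply/mem_homA => b x.
by rewrite !comp_lfunE hu /= !lfunE /= mulrA.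
Qed.

Lemma lact_linear : linear lact.
Proof.
move=> c a b; apply/lfunP => u; apply: val_inj.
rewrite [LHS]val_lact linearP /= comp_lfunDl -comp_lfunZl.
by rewrite add_lfunE scale_lfunE linearP /= !val_lact.
Qed.

Lemma lact1 : lact 1 = \1%VF.
Proof.
apply/lfunP => u; apply: val_inj.
by rewrite [LHS]val_lact amull1 comp_lfun1l lfunE.
Qed.

Lemma lactM a b : lact (a * b) = (lact a \o lact b)%VF.
Proof.
apply/lfunP => u; apply: val_inj.
rewrite [LHS]val_lact comp_lfunE [RHS]val_lact val_lact comp_lfunA.
by congr (_ \o _)%VF; apply/lfunP => x; rewrite comp_lfunE !lfunE /= mulrA.
Qed.

End HomA.

(* D Hom_A(X, A), with (phi a)(f) = phi (a f). *)
Definition nakayama (X : rmod A) : rmod A.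
Proof.
refine (@RMod k A 'Hom(subvs_of (homA X), k^o)
  (fun a => linfun (@precomp _ _ k^o (lact X a))) _ _ _).
- move=> c a b; apply/lfunP => phi; rewrite add_lfunE scale_lfunE !lfunE /=.
  by rewrite /precomp lact_linear comp_lfunDr -[in LHS]comp_lfunZr.
- by move=> phi; rewrite lfunE /= /precomp lact1 comp_lfun1r.
- by move=> a b phi; rewrite !lfunE /= /precomp lactM comp_lfunA.
Defined.

Definition indecomposable M : Prop :=
  (exists x : M, x <> 0) /\
  forall U V : {vspace M}, submodule U -> submodule V ->
    (U + V)%VS = fullv -> (U :&: V)%VS = 0%VS -> U = 0%VS \/ V = 0%VS.

Definition basic_mod M : Prop :=
  exists s : seq (rmod A),
    [/\ riso M (foldr rsum rzero s),
        forall i, (i < size s)%N -> indecomposable (nth rzero s i)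
      & forall i j, (i < size s)%N -> (j < size s)%N -> i <> j ->
          ~ riso (nth rzero s i) (nth rzero s j)].

Definition basic_alg : Prop := basic_mod regmod.

(* The sub-bimodules of A are its two-sided ideals. *)
Definition subbimod (U : {vspace A}) : Prop :=
  forall a b x : A, x \in U -> a * x * b \in U.

(* A is nonzero by definition of [falgType]. *)
Definition bimod_indecomposable : Prop :=
  forall U V : {vspace A}, subbimod U -> subbimod V ->
    (U + V)%VS = fullv -> (U :&: V)%VS = 0%VS -> U = 0%VS \/ V = 0%VS.

End Modules.

Section Homotopy.
Variables (k : fieldType) (A : falgType k).

(* Only the components [cd C i j] with j = i + 1 are meaningful; indexing the
   differential by both degrees avoids casts between C (i + 1 + n) and
   C (i + n + 1). *)
Record cpx := Cpx {
  cobj :> int -> pmod A;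
  cd : forall i j, 'Hom(cobj i, cobj j);
  cd_rhom : forall i j, rhom (cd i j);
  cd_cd : forall i j l, j = i + 1 -> l = j + 1 -> (cd j l \o cd i j)%VF = 0;
  cbounded : exists N : nat, forall i, (N < `|i|)%N -> forall x : cobj i, x = 0
}.

Record chmap (X Y : cpx) := ChMap {
  cm :> forall i, 'Hom(X i, Y i);
  cm_rhom : forall i, rhom (cm i);
  cm_comm : forall i j, j = i + 1 -> (cm j \o cd X i j = cd Y i j \o cm i)%VF
}.

Definition chid X : chmap X X.
Proof.
refine (@ChMap X X (fun i => \1%VF) _ _).
- by move=> i; apply: rhom1.
- by move=> i j _; rewrite comp_lfun1l comp_lfun1r.
Defined.

Definition chzero X Y : chmap X Y.
Proof.
refine (@ChMap X Y (fun i => 0) _ _).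
- by move=> i; apply: rhom0.
- by move=> i j _; rewrite comp_lfun0l comp_lfun0r.
Defined.

Definition chcomp X Y Z (g : chmap Y Z) (f : chmap X Y) : chmap X Z.
Proof.
refine (@ChMap X Z (fun i => (g i \o f i)%VF) _ _).
- by move=> i; exact: rhom_comp (@cm_rhom _ _ g i) (@cm_rhom _ _ f i).
- by move=> i j e; rewrite -comp_lfunA cm_comm // !comp_lfunA cm_comm.
Defined.

(* Equality of morphisms in K^b(proj-A). *)
Definition homotopic X Y (f g : chmap X Y) : Prop :=
  exists h : forall i j, 'Hom(X i, Y j),
    (forall i j, rhom (h i j)) /\
    forall i j l, j = i + 1 -> l = j + 1 ->
      f j - g j = ((cd Y i j \o h j i) + (h l j \o cd X j l))%VF.

Definition chiso X Y (f : chmap X Y) : Prop :=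
  exists g : chmap Y X,
    homotopic (chcomp g f) (chid X) /\ homotopic (chcomp f g) (chid Y).

Definition isoT X Y : Prop := exists f : chmap X Y, chiso f.

Definition shift (X : cpx) (n : int) : cpx.
Proof.
refine (@Cpx (fun i => X (i + n))
  (fun i j => (-1) ^ n *: cd X (i + n) (j + n)) _ _ _).
- by move=> i j; apply: rhomZ; apply: cd_rhom.
- move=> i j l ej el; rewrite -comp_lfunZl -comp_lfunZr cd_cd ?scaler0 //; lia.
- have [N hN] := cbounded X; exists (N + `|n|)%N => i hi; apply: hN; lia.
Defined.

Definition shiftmap X Y (f : chmap X Y) (n : int) : chmap (shift X n) (shift Y n).
Proof.
refine (@ChMap (shift X n) (shift Y n) (fun i => f (i + n)) _ _).
- by move=> i; exact: (@cm_rhom _ _ f).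
- move=> i j e /=; rewrite -comp_lfunZl -comp_lfunZr cm_comm //; lia.
Defined.

Definition csum (X Y : cpx) : cpx.
Proof.
refine (@Cpx (fun i => psum (X i) (Y i))
  (fun i j => ((in1 _ _ \o cd X i j \o pr1 _ _) +
               (in2 _ _ \o cd Y i j \o pr2 _ _))%VF) _ _ _).
- move=> i j; apply: rhomD; (apply: rhom_comp; first apply: rhom_comp).
  + exact: rhom_in1.
  + exact: cd_rhom.
  + exact: rhom_pr1.
  + exact: rhom_in2.
  + exact: cd_rhom.
  + exact: rhom_pr2.
- move=> i j l ej el; apply/lfunP => p.
  rewrite !(comp_lfunE, add_lfunE) !biprodE /= addr0 add0r -!comp_lfunE.
  by rewrite !cd_cd // !lfunE /= addr0.
- have [N hN] := cbounded X; have [N' hN'] := cbounded Y.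
  exists (maxn N N') => i hi [x y].
  by rewrite (hN i _ x) ?(hN' i _ y) //; lia.
Defined.

(* The identity of X i if i = j, and 0 otherwise. *)
Definition diag (X : cpx) i j : 'Hom(X i, X j) :=
  match i =P j with
  | ReflectT e => match e in _ = j return 'Hom(X i, X j) with erefl => \1%VF end
  | ReflectF _ => 0
  end.

Lemma diag_id X i : diag X i i = \1%VF.
Proof.
by rewrite /diag; case: eqP => // e; rewrite (eq_irrelevance e erefl).
Qed.

Lemma diag_rhom X i j : rhom (diag X i j).
Proof.
by rewrite /diag; case: eqP => [e|_]; [case: _ / e; apply: rhom1|apply: rhom0].
Qed.

(* Cone(f)^i = X^(i+1) (+) Y^i, with d(x, y) = (- d x, f x + d y). *)
Definition cone X Y (f : chmap X Y) : cpx.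
Proof.
refine (@Cpx (fun i => psum (X (i + 1)) (Y i))
  (fun i j => (- (in1 _ _ \o cd X (i + 1) (j + 1) \o pr1 _ _) +
               (in2 _ _ \o diag Y (i + 1) j \o f (i + 1) \o pr1 _ _) +
               (in2 _ _ \o cd Y i j \o pr2 _ _))%VF) _ _ _).
- move=> i j; apply: rhomD; first apply: rhomD; first apply: rhomN.
  + apply: rhom_comp (@rhom_pr1 _ _ _ _); apply: rhom_comp (@rhom_in1 _ _ _ _) _.
    exact: cd_rhom.
  + apply: rhom_comp (@rhom_pr1 _ _ _ _); apply: rhom_comp; last exact: (@cm_rhom _ _ f).
    apply: rhom_comp (@rhom_in2 _ _ _ _) _; exact: diag_rhom.
  + apply: rhom_comp (@rhom_pr2 _ _ _ _); apply: rhom_comp (@rhom_in2 _ _ _ _) _.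
    exact: cd_rhom.
- move=> i j l ej el; subst j l; apply/lfunP => p.
  rewrite !(comp_lfunE, add_lfunE, opp_lfunE) !biprodE !diag_id !lfunE /=.
  have dX : cd X (i + 1 + 1) (i + 1 + 1 + 1) (cd X (i + 1) (i + 1 + 1) p.1) = 0.
    by rewrite -comp_lfunE cd_cd // lfunE.
  have dY : cd Y (i + 1) (i + 1 + 1) (cd Y i (i + 1) p.2) = 0.
    by rewrite -comp_lfunE cd_cd // lfunE.
  have fd : f (i + 1 + 1) (cd X (i + 1) (i + 1 + 1) p.1)
            = cd Y (i + 1) (i + 1 + 1) (f (i + 1) p.1).
    by rewrite -!comp_lfunE cm_comm.
  apply: injective_projections; rewrite /= ?addr0 ?add0r ?oppr0 ?add0r ?addr0.
    by rewrite linearN /= dX !oppr0.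
  by rewrite linearN linearD /= fd dY addr0 addNr.
- have [N hN] := cbounded X; have [N' hN'] := cbounded Y.
  exists (maxn N.+1 N') => i hi [x y].
  by rewrite (hN (i + 1) _ x) ?(hN' i _ y) //; lia.
Defined.

Definition cone_in X Y (f : chmap X Y) : chmap Y (cone f).
Proof.
refine (@ChMap Y (cone f) (fun i => in2 _ _) _ _).
- by move=> i; apply: rhom_in2.
- move=> i j _; apply/lfunP => y.
  rewrite !(comp_lfunE, add_lfunE, opp_lfunE) !biprodE /= !linear0.
  by apply: injective_projections; rewrite /= ?oppr0 ?addr0 ?add0r.
Defined.

Definition cone_pr X Y (f : chmap X Y) : chmap (cone f) (shift X 1).
Proof.
refine (@ChMap (cone f) (shift X 1) (fun i => pr1 _ _) _ _).
- by move=> i; apply: rhom_pr1.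
- move=> i j _; apply/lfunP => p.
  rewrite !(comp_lfunE, add_lfunE, opp_lfunE, scale_lfunE) !biprodE /=.
  by rewrite !addr0 expr1z scaleN1r.
Defined.

(* A triangle X -u-> Y -v-> Z -w-> X[1] is distinguished if it is isomorphic to
   a standard triangle. *)
Definition distinguished X Y Z (u : chmap X Y) (v : chmap Y Z)
    (w : chmap Z (shift X 1)) : Prop :=
  exists X' Y' (f : chmap X' Y')
      (a : chmap X X') (b : chmap Y Y') (c : chmap Z (cone f)),
    [/\ [/\ chiso a, chiso b & chiso c],
        homotopic (chcomp b u) (chcomp f a),
        homotopic (chcomp c v) (chcomp (cone_in f) b)
      & homotopic (chcomp (shiftmap a 1) w) (chcomp (cone_pr f) c)].

Definition czero : cpx.
Proof.
refine (@Cpx (fun _ => pzero A) (fun _ _ => 0) _ _ _).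
- by move=> i j; apply: rhom0.
- by move=> i j l _ _; rewrite comp_lfun0l.
- by exists 0%N => i _ x; apply/rowP; case.
Defined.

Record thick (S : cpx -> Prop) : Prop := Thick {
  thick_zero : S czero;
  thick_iso : forall X Y, isoT X Y -> S X -> S Y;
  thick_shift : forall X n, S X -> S (shift X n);
  thick_cone : forall X Y Z (u : chmap X Y) (v : chmap Y Z)
    (w : chmap Z (shift X 1)), distinguished u v w -> S X -> S Y -> S Z;
  thick_summand : forall X Y, S (csum X Y) -> S X
}.

(* The smallest thick subcategory containing M is everything. *)
Definition generates (M : cpx) : Prop :=
  forall S, thick S -> S M -> forall X, S X.

Definition hom_zero (X Y : cpx) : Prop :=
  forall f : chmap X Y, homotopic f (chzero X Y).

Definition silting (M : cpx) : Prop :=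
  (forall i : int, 0 < i -> hom_zero M (shift M i)) /\ generates M.

Definition tilting (M : cpx) : Prop :=
  (forall i : int, i != 0 -> hom_zero M (shift M i)) /\ generates M.

Inductive add_closure (M : cpx) : cpx -> Prop :=
| add_self : add_closure M M
| add_zero : add_closure M czero
| add_sum X Y : add_closure M X -> add_closure M Y -> add_closure M (csum X Y)
| add_summand X Y : add_closure M (csum X Y) -> add_closure M X
| add_iso X Y : isoT X Y -> add_closure M X -> add_closure M Y.

Definition right_approx (M D X : cpx) (g : chmap D X) : Prop :=
  add_closure M D /\
  forall D' (u : chmap D' X), add_closure M D' ->
    exists v : chmap D' D, homotopic (chcomp g v) u.

Definition right_minimal (D X : cpx) (g : chmap D X) : Prop :=
  forall h : chmap D D, homotopic (chcomp g h) g -> chiso h.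

(* [right_mutation M X M' Y]: M = X (+) M' and Y is (isomorphic to) the right
   mutation of M with respect to X. *)
Definition right_mutation (M X M' Y : cpx) : Prop :=
  isoT M (csum X M') /\
  exists N D (a : chmap N D) (g : chmap D X) (b : chmap X (shift N 1)),
    [/\ right_approx M' g, right_minimal g, distinguished a g b
      & isoT Y (csum N M')].

(* P in degree 0 and Q in degree 1. *)
Definition two_term_obj (P Q : pmod A) (i : int) : pmod A :=
  match i with Posz 0 => P | Posz 1 => Q | _ => pzero A end.

Definition two_term_d (P Q : pmod A) (p : 'Hom(P, Q)) (i j : int) :
    'Hom(two_term_obj P Q i, two_term_obj P Q j) :=
  match i, j return 'Hom(two_term_obj P Q i, two_term_obj P Q j) with
  | Posz 0, Posz 1 => p
  | _, _ => 0
  end.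

Definition two_term (P Q : pmod A) (p : 'Hom(P, Q)) (hp : rhom p) : cpx.
Proof.
refine (@Cpx (two_term_obj P Q) (two_term_d p) _ _ _).
- by move=> [[|[|i]]|i] [[|[|j]]|j] //=; apply: rhom0.
- move=> [[|[|i]]|i] j l -> -> //=; rewrite ?comp_lfun0l ?comp_lfun0r //.
- by exists 1%N => -[[|[|i]]|[|i]] //= _ x; apply/rowP; case.
Defined.

Definition stalk_obj (P : pmod A) (i : int) : pmod A :=
  match i with Posz 0 => P | _ => pzero A end.

Definition stalk (P : pmod A) : cpx.
Proof.
refine (@Cpx (stalk_obj P) (fun _ _ => 0) _ _ _).
- by move=> i j; apply: rhom0.
- by move=> i j l _ _; rewrite comp_lfun0l.
- by exists 0%N => -[[|i]|i] //= _ x; apply/rowP; case.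
Defined.

Section OkuyamaRickard.
Variables (e : A) (he : e * e = e) (P : projcover (eAe'A e)).

Definition p_e : 'Hom(P, peA he) := (eAe'A_incl e \o pc_map P)%VF.

Lemma p_e_rhom : rhom p_e.
Proof. by apply: rhom_comp; [apply: eAe'A_incl_rhom | apply: pc_rhom]. Qed.

Definition okuyama_rickard : cpx :=
  csum (two_term p_e_rhom) (stalk (peA (idem_compl he))).

End OkuyamaRickard.

End Homotopy.

(* Main.v *)
From HB Require Import structures.
Require Import Defs.
From mathcomp Require Import all_boot all_order all_algebra all_field.
From mathcomp Require Import zify.
From Stdlib Require Import Classical_Prop.

(** Write e' = 1 - e. The projective cover P of eAe'A lies in add e'A, because
    eAe'A is generated by its elements x e', and every map from a module of
    add e'A to eA has its image in eAe'A, hence factors through p_e : P -> eA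
    ([projcover_madd], [madd_trace], [madd_lift]). So p_e is a right
    approximation of eA, minimal because P is a projective cover, and the
    two-term complex (P -> eA) completes it to a triangle
    (P -> eA) -> P -> eA -> (P -> eA)[1] ([exchange_triangle]); this is (a).
    For uniqueness, minimal approximations of eA are isomorphic, isomorphic maps
    have isomorphic cones, and by rotation the first vertex of a triangle is the
    shifted cone of its second map ([isoT_cone], [distinguished_cone],
    [right_mutation_unique]).

    A thick subcategory containing T contains e'A, hence P, hence eA by the
    triangle, hence A; and A generates, by induction on the number of nonzero
    components, since cutting a complex in two degreewise gives a triangle
    ([isoT_cone_split], [thick_all]). As T lives in degrees 0 and 1, Hom(T, T[i])
    is zero for i > 1 and i < -1; it is zero for i = 1 because every map from
    P + e'A to eA factors through p_e ([hom_zero_shift1]). This is (b). Finally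
    Hom(T, T[-1]) is the space of maps eA -> P + e'A that vanish on eAe'A
    ([hom_zero_shiftN1]); as P is in add e'A, it is zero if and only if
    Hom(eA/eAe'A, e'A) = 0 ([madd_kill], [okuyama_rickard_tilting]), which is (c).

    For (d), a nonzero map eA/eAe'A -> e'A sends e to some x in e'A with x <> 0
    and xAe' = 0; choose x with xA of minimal dimension. For a linear functional
    phi with phi(x) <> 0, the map y |-> (u |-> phi(y u(e))) from e'A to
    D Hom(eA, A), which is isomorphic to eA, is injective on xA by minimality.
    Since e'A is injective, some map back eA -> e'A makes the composite
    endomorphism of e'A fix xA, so by Fitting's lemma eA and e'A share a nonzero,
    hence an indecomposable, direct summand. This contradicts that A is basic:
    endomorphism rings of indecomposables are local, and therefore a direct sum
    of pairwise non-isomorphic indecomposables contains no summand twice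
    ([fitting], [indec_not_twice], [self_injective_vanish]). *)

Set Implicit Arguments.
Unset Strict Implicit.
Unset Printing Implicit Defensive.

Import GRing.Theory.
Local Open Scope ring_scope.

(** * Linear maps and module homomorphisms *)

Section LinearTools.
Variable k : fieldType.

(** The linear map given by a function together with a proof of linearity. *)
Definition mklin (U V : vectType k) (f : U -> V) (hf : linear f) : 'Hom(U, V) :=
  linfun (HB.pack_for {linear U -> V} f
    (GRing.isSemilinear.Build k U V _ f (GRing.semilinear_linear hf))).

Lemma mklinE (U V : vectType k) (f : U -> V) (hf : linear f) x :
  mklin hf x = f x.
Proof. by rewrite lfunE. Qed.

(** The map into a product with components f and g. It is locked, so that the
    rewrite rule for values of a sum of maps does not unfold it. *)
Definition pairl (U V W : vectType k) (f : 'Hom(U, V)) (g : 'Hom(U, W)) :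
    'Hom(U, (V * W)%type) :=
  locked ((in1 V W \o f) + (in2 V W \o g))%VF.

Lemma pairlE (U V W : vectType k) (f : 'Hom(U, V)) (g : 'Hom(U, W)) x :
  pairl f g x = (f x, g x).
Proof.
rewrite /pairl -lock add_lfunE !comp_lfunE !biprodE.
by apply: injective_projections; rewrite /= ?addr0 ?add0r.
Qed.

(** The map out of a product with components f and g, locked likewise. *)
Definition copairl (U V W : vectType k) (f : 'Hom(V, U)) (g : 'Hom(W, U)) :
    'Hom((V * W)%type, U) :=
  locked ((f \o pr1 V W) + (g \o pr2 V W))%VF.

Lemma copairlE (U V W : vectType k) (f : 'Hom(V, U)) (g : 'Hom(W, U)) p :
  copairl f g p = f p.1 + g p.2.
Proof. by rewrite /copairl -lock add_lfunE !comp_lfunE !biprodE. Qed.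

Lemma lfun0E (U V : vectType k) x : (0 : 'Hom(U, V)) x = 0.
Proof. by rewrite lfunE. Qed.

End LinearTools.

(** Values of the elementary operations on linear maps. *)
Definition lE := (comp_lfunE, add_lfunE, opp_lfunE, scale_lfunE, id_lfunE,
                  pairlE, copairlE, biprodE, lfun0E).

Section RhomTools.
Variables (k : fieldType) (A : falgType k).
Implicit Types M N X Y : rmod A.

Lemma rhom_pairl M N X (f : 'Hom(M, N)) (g : 'Hom(M, X)) :
  rhom f -> rhom g -> @rhom _ _ M (rsum N X) (pairl f g).
Proof. by move=> hf hg a x; rewrite ract_sumE !lE hf hg. Qed.

Lemma rhom_copairl M N X (f : 'Hom(N, M)) (g : 'Hom(X, M)) :
  rhom f -> rhom g -> @rhom _ _ (rsum N X) M (copairl f g).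
Proof. by move=> hf hg a x; rewrite ract_sumE !copairlE hf hg linearD. Qed.

End RhomTools.

(** Proves that a map is A-linear by following the way it is built. *)
Ltac rhom_auto :=
  lazymatch goal with
  | |- @rhom _ _ _ _ ?t =>
    lazymatch t with
    | @comp_lfun _ _ _ _ _ _ => apply: rhom_comp; rhom_auto
    | @pairl _ _ _ _ _ _ => apply: rhom_pairl; rhom_auto
    | @copairl _ _ _ _ _ _ => apply: rhom_copairl; rhom_auto
    | @GRing.add _ _ _ => apply: rhomD; rhom_auto
    | @GRing.opp _ _ => apply: rhomN; rhom_auto
    | @GRing.scale _ _ _ _ => apply: rhomZ; rhom_auto
    | @GRing.zero _ => exact: rhom0
    | @id_lfun _ _ => exact: rhom1
    | @pr1 _ _ _ => exact: rhom_pr1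
    | @pr2 _ _ _ => exact: rhom_pr2
    | @in1 _ _ _ => exact: rhom_in1
    | @in2 _ _ _ => exact: rhom_in2
    | @cd _ _ ?X ?i ?j => exact: (@cd_rhom _ _ X i j)
    | @cm _ _ _ _ ?f ?i => exact: (@cm_rhom _ _ _ _ f i)
    | @diag _ _ ?X ?i ?j => exact: (@diag_rhom _ _ X i j)
    | _ => auto
    end
  end.

(** * The homotopy category *)

(* The differentials are evaluated with the lemmas below instead. *)
Arguments cone : simpl never.
Arguments csum : simpl never.
Arguments shift : simpl never.

Section Homotopy.
Variables (k : fieldType) (A : falgType k).
Implicit Types X Y Z W : cpx A.

(** Differentials and homotopies are evaluated in degree i + 1, so that no
    degree i - 1 occurs; this loses nothing. *)
Lemma int_succ_ind (Q : int -> Prop) : (forall i, Q (i + 1)) -> forall i, Q i.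
Proof. by move=> h i; rewrite -(subrK 1 i); apply: h. Qed.

Lemma cd_cdE X i x : cd X (i + 1) (i + 1 + 1) (cd X i (i + 1) x) = 0.
Proof. by rewrite -comp_lfunE cd_cd // lfunE. Qed.

Lemma cm_commE X Y (f : chmap X Y) i x :
  f (i + 1) (cd X i (i + 1) x) = cd Y i (i + 1) (f i x).
Proof. by rewrite -!comp_lfunE cm_comm. Qed.

Lemma shift_dE X n i j x :
  cd (shift X n) i j x = (-1) ^ n *: cd X (i + n) (j + n) x.
Proof. by rewrite /shift /= scale_lfunE. Qed.

Lemma shift1_dE X i j x : cd (shift X 1) i j x = - cd X (i + 1) (j + 1) x.
Proof. by rewrite shift_dE expr1z scaleN1r. Qed.

Lemma csum_dE X Y i j p :
  cd (csum X Y) i j p = (cd X i j p.1, cd Y i j p.2).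
Proof.
by rewrite /csum /= !lE; apply: injective_projections; rewrite /= ?addr0 ?add0r.
Qed.

Lemma cone_dE X Y (f : chmap X Y) i p :
  cd (cone f) i (i + 1) p =
  (- cd X (i + 1) (i + 1 + 1) p.1, f (i + 1) p.1 + cd Y i (i + 1) p.2).
Proof.
rewrite /cone /= !lE diag_id !lE; apply: injective_projections => /=.
  by rewrite !addr0.
by rewrite oppr0 add0r.
Qed.

(** A chain map from its components, with commutation checked on elements. *)
Lemma chmapI X Y (f : forall i, 'Hom(X i, Y i)) :
  (forall i, rhom (f i)) ->
  (forall i x, f (i + 1) (cd X i (i + 1) x) = cd Y i (i + 1) (f i x)) ->
  exists g : chmap X Y, forall i x, g i x = f i x.
Proof.
move=> hf hc.
have hc' i j : j = i + 1 -> (f j \o cd X i j = cd Y i j \o f i)%VF.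
  by move=> ->; apply/lfunP => x; rewrite !comp_lfunE hc.
by exists (ChMap hf hc').
Qed.

Lemma homotopicI X Y (f g : chmap X Y) (h : forall i j, 'Hom(X i, Y j)) :
  (forall i j, rhom (h i j)) ->
  (forall i x, f (i + 1) x - g (i + 1) x =
     cd Y i (i + 1) (h (i + 1) i x) +
     h (i + 1 + 1) (i + 1) (cd X (i + 1) (i + 1 + 1) x)) ->
  homotopic f g.
Proof.
move=> hr hh; exists h; split=> // i j l -> ->; apply/lfunP => x.
by rewrite !lE hh.
Qed.

Lemma homotopicE X Y (f g : chmap X Y) : homotopic f g ->
  exists2 h : forall i j, 'Hom(X i, Y j), (forall i j, rhom (h i j)) &
  forall i x, f (i + 1) x - g (i + 1) x =
     cd Y i (i + 1) (h (i + 1) i x) +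
     h (i + 1 + 1) (i + 1) (cd X (i + 1) (i + 1 + 1) x).
Proof.
move=> [h [hr hh]]; exists h => // i x.
by have /lfunP/(_ x) := hh i _ _ erefl erefl; rewrite !lE.
Qed.

Lemma homotopic_eq X Y (f g : chmap X Y) :
  (forall i x, f i x = g i x) -> homotopic f g.
Proof.
move=> E; apply: (@homotopicI _ _ _ _ (fun i j => 0)).
  by move=> i j; apply: rhom0.
by move=> i x; rewrite E subrr !lE linear0 addr0.
Qed.

Lemma homotopic_refl X Y (f : chmap X Y) : homotopic f f.
Proof. exact: homotopic_eq. Qed.

Lemma homotopic_sym X Y (f g : chmap X Y) : homotopic f g -> homotopic g f.
Proof.
move=> /homotopicE[h hr hh]; apply: (@homotopicI _ _ _ _ (fun i j => - h i j)).
  by move=> i j; apply: rhomN.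
by move=> i x; rewrite -opprB hh !lE linearN opprD.
Qed.

Lemma homotopic_trans X Y (g f l : chmap X Y) :
  homotopic f g -> homotopic g l -> homotopic f l.
Proof.
move=> /homotopicE[h hr hh] /homotopicE[h' hr' hh'].
apply: (@homotopicI _ _ _ _ (fun i j => h i j + h' i j)).
  by move=> i j; apply: rhomD.
move=> i x; rewrite -[LHS](subrKA (g (i + 1) x)) hh hh' !lE linearD /=.
by rewrite addrACA.
Qed.

Lemma homotopic_comp X Y Z (f f' : chmap X Y) (g g' : chmap Y Z) :
  homotopic f f' -> homotopic g g' -> homotopic (chcomp g f) (chcomp g' f').
Proof.
move=> /homotopicE[h hr hh] /homotopicE[h' hr' hh'].
apply: (@homotopicI _ _ _ _ (fun i j => (g j \o h i j) + (h' i j \o f' i))%VF).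
  by move=> i j; rhom_auto.
move=> i x; rewrite !lE -[LHS](subrKA (g (i + 1) (f' (i + 1) x))) -linearB hh.
by rewrite hh' !linearD /= !cm_commE addrACA.
Qed.

Lemma homotopic_compl X Y Z (f f' : chmap X Y) (g : chmap Y Z) :
  homotopic f f' -> homotopic (chcomp g f) (chcomp g f').
Proof. by move=> h; apply: homotopic_comp h (homotopic_refl _). Qed.

Lemma homotopic_compr X Y Z (f : chmap X Y) (g g' : chmap Y Z) :
  homotopic g g' -> homotopic (chcomp g f) (chcomp g' f).
Proof. by move=> h; apply: homotopic_comp (homotopic_refl _) h. Qed.

Lemma chcompA X Y Z W (f : chmap X Y) (g : chmap Y Z) (h : chmap Z W) :
  homotopic (chcomp h (chcomp g f)) (chcomp (chcomp h g) f).
Proof. by apply: homotopic_eq => i x; rewrite !lE. Qed.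

Lemma chcomp1l X Y (f : chmap X Y) : homotopic (chcomp (chid Y) f) f.
Proof. by apply: homotopic_eq => i x; rewrite !lE. Qed.

Lemma chcomp1r X Y (f : chmap X Y) : homotopic (chcomp f (chid X)) f.
Proof. by apply: homotopic_eq => i x; rewrite !lE. Qed.

Lemma chiso_id X : chiso (chid X).
Proof. by exists (chid X); split; apply: chcomp1l. Qed.

Lemma chiso_comp X Y Z (f : chmap X Y) (g : chmap Y Z) :
  chiso f -> chiso g -> chiso (chcomp g f).
Proof.
have H X' Y' Z' (a : chmap X' Y') (a' : chmap Y' X') (b : chmap Y' Z')
    (b' : chmap Z' Y') : homotopic (chcomp a' a) (chid X') ->
    homotopic (chcomp b' b) (chid Y') ->
    homotopic (chcomp (chcomp a' b') (chcomp b a)) (chid X').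
  move=> ha hb; apply: homotopic_trans ha.
  apply: homotopic_trans (homotopic_compl _ (chcomp1l a)).
  apply: homotopic_trans (homotopic_compl _ (homotopic_compr _ hb)).
  by apply: homotopic_eq => i x; rewrite !lE.
move=> [f' [hf hf']] [g' [hg hg']]; exists (chcomp f' g'); split; exact: H.
Qed.

Lemma isoT_refl X : isoT X X.
Proof. by exists (chid X); apply: chiso_id. Qed.

Lemma isoT_sym X Y : isoT X Y -> isoT Y X.
Proof. by move=> [f [g [h h']]]; exists g, f. Qed.

Lemma isoT_trans Y X Z : isoT X Y -> isoT Y Z -> isoT X Z.
Proof.
by move=> [f hf] [g hg]; exists (chcomp g f); apply: chiso_comp.
Qed.

Lemma isoT_strict X Y (f : chmap X Y) (g : chmap Y X) :
  (forall i x, g i (f i x) = x) -> (forall i x, f i (g i x) = x) -> isoT X Y.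
Proof.
by move=> h1 h2; exists f, g; split; apply: homotopic_eq => i x; rewrite !lE.
Qed.

(** A left and a right inverse up to homotopy may be different. *)
Lemma chiso_lr X Y (f : chmap X Y) (g g' : chmap Y X) :
  chiso (chcomp g f) -> chiso (chcomp f g') -> chiso f.
Proof.
move=> [a [ha _]] [b [_ hb]].
pose l := chcomp a g; pose r := chcomp g' b.
have hl : homotopic (chcomp l f) (chid X).
  by apply: homotopic_trans ha; apply/homotopic_sym/chcompA.
have hr : homotopic (chcomp f r) (chid Y).
  by apply: homotopic_trans hb; apply: chcompA.
exists l; split=> //; apply: homotopic_trans (hr); apply: homotopic_compl.
apply: homotopic_trans (chcomp1l r).
apply: homotopic_trans (homotopic_compr r hl).
apply: homotopic_trans (chcompA _ _ _).
apply: homotopic_trans (homotopic_sym (chcomp1r l)) _.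
by apply: homotopic_compl; apply: homotopic_sym.
Qed.

End Homotopy.

(** * Shifts, sums and cones *)

Section Shift.
Variables (k : fieldType) (A : falgType k).
Implicit Types X Y Z W : cpx A.

Lemma signz_sqr (n : int) : (-1) ^ n * (-1) ^ n = 1 :> k.
Proof. by rewrite -exprzMl ?unitrN1 // mulrNN mulr1 exp1rz. Qed.

(** The homotopy of a shift carries the same sign as the differential, so that
    their products carry none. *)
Lemma homotopic_shiftmap X Y (f g : chmap X Y) n :
  homotopic f g -> homotopic (shiftmap f n) (shiftmap g n).
Proof.
move=> [h [hr hh]].
apply: (@homotopicI _ _ (shift X n) (shift Y n) _ _
  (fun i j => (-1) ^ n *: h (i + n) (j + n))).
  by move=> i j; apply: rhomZ; apply: hr.
move=> i x; rewrite !shift_dE !lE linearZ /= !scalerA -?scalerAr signz_sqr scale1r.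
have /lfunP/(_ x) := hh (i + n) (i + 1 + n) (i + 1 + 1 + n) ltac:(lia) ltac:(lia).
by rewrite !lE => ->; rewrite linearZ /= scalerA signz_sqr scale1r.
Qed.

Lemma isoT_shift X Y n : isoT X Y -> isoT (shift X n) (shift Y n).
Proof.
move=> [f [g [h h']]]; exists (shiftmap f n), (shiftmap g n).
split.
  have := homotopic_shiftmap n h; apply: homotopic_trans.
  by apply: homotopic_eq => i x; rewrite !lE.
have := homotopic_shiftmap n h'; apply: homotopic_trans.
by apply: homotopic_eq => i x; rewrite !lE.
Qed.

(** [diag X i j] transports X i to X j along an equality of degrees. *)
Lemma diag_comm X i j i' j' x : i = j -> i' = j' ->
  diag X i' j' (cd X i i' x) = cd X j j' (diag X i j x).
Proof. by move=> eij eij'; subst j j'; rewrite !diag_id !lE. Qed.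

Lemma diagK X i j x : i = j -> diag X j i (diag X i j x) = x.
Proof. by move=> eij; subst j; rewrite !diag_id !lE. Qed.

Lemma isoT_unshift X (n m : int) : n + m = 0 -> isoT (shift (shift X n) m) X.
Proof.
move=> nm.
have sgn : (-1) ^ m * (-1) ^ n = 1 :> k.
  by rewrite -expfzDr ?oppr_eq0 ?oner_eq0 // addrC nm expr0z.
have E i : i + m + n = i by rewrite -addrA (addrC m) nm addr0.
have dE i j x : cd (shift (shift X n) m) i j x = cd X (i + m + n) (j + m + n) x.
  by rewrite shift_dE shift_dE scalerA sgn scale1r.
have [||f fE] := @chmapI _ _ (shift (shift X n) m) X
  (fun i => diag X (i + m + n) i).
- by move=> i; apply: (@diag_rhom _ _ X).
- by move=> i x; rewrite dE; apply: (@diag_comm X).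
have [||g gE] := @chmapI _ _ X (shift (shift X n) m)
  (fun i => diag X i (i + m + n)).
- by move=> i; apply: (@diag_rhom _ _ X).
- by move=> i x; rewrite dE; apply: (@diag_comm X).
apply: (isoT_strict (f := f) (g := g)) => i x; 
  by rewrite fE gE; apply: (@diagK X); rewrite E.
Qed.

Lemma isoT_shift_inj X Y (n : int) : isoT (shift X n) (shift Y n) -> isoT X Y.
Proof.
move=> /(isoT_shift (- n)) h.
apply: isoT_trans (isoT_unshift Y (subrr n)).
by apply: isoT_trans h; apply/isoT_sym/isoT_unshift/subrr.
Qed.

Lemma chmap_in1 X Y : exists j : chmap X (csum X Y), forall i x, j i x = (x, 0).
Proof.
have [||j jE] := @chmapI _ _ X (csum X Y) (fun i => in1 _ _).
- by move=> i; rhom_auto.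
- by move=> i x; rewrite csum_dE !biprodE /= linear0.
by exists j => i x; rewrite jE biprodE.
Qed.

Lemma chmap_in2 X Y : exists j : chmap Y (csum X Y), forall i y, j i y = (0, y).
Proof.
have [||j jE] := @chmapI _ _ Y (csum X Y) (fun i => in2 _ _).
- by move=> i; rhom_auto.
- by move=> i y; rewrite csum_dE !biprodE /= linear0.
by exists j => i y; rewrite jE biprodE.
Qed.

Lemma chmap_pr1 X Y : exists q : chmap (csum X Y) X, forall i p, q i p = p.1.
Proof.
have [||q qE] := @chmapI _ _ (csum X Y) X (fun i => pr1 _ _).
- by move=> i; rhom_auto.
- by move=> i p; rewrite csum_dE !biprodE.
by exists q => i p; rewrite qE biprodE.
Qed.

Lemma chmap_pr2 X Y : exists q : chmap (csum X Y) Y, forall i p, q i p = p.2.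
Proof.
have [||q qE] := @chmapI _ _ (csum X Y) Y (fun i => pr2 _ _).
- by move=> i; rhom_auto.
- by move=> i p; rewrite csum_dE !biprodE.
by exists q => i p; rewrite qE biprodE.
Qed.

Lemma isoT_csum X X' Y Y' :
  isoT X X' -> isoT Y Y' -> isoT (csum X Y) (csum X' Y').
Proof.
have mk X1 X2 Y1 Y2 (f : chmap X1 X2) (g : chmap Y1 Y2) :
    exists l : chmap (csum X1 Y1) (csum X2 Y2),
    forall i p, l i p = (f i p.1, g i p.2).
  have [||l ElE] := @chmapI _ _ (csum X1 Y1) (csum X2 Y2)
    (fun i => pairl (f i \o pr1 _ _)%VF (g i \o pr2 _ _)%VF).
  - by move=> i; rhom_auto.
  - by move=> i x; rewrite !csum_dE !lE !cm_commE.
  by exists l => i p; rewrite ElE !lE.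
have ht X1 X2 Y1 Y2 (f : chmap X1 X2) (g : chmap Y1 Y2)
    (f' : chmap X2 X1) (g' : chmap Y2 Y1) (l : chmap (csum X1 Y1) (csum X2 Y2))
    (l' : chmap (csum X2 Y2) (csum X1 Y1)) :
    (forall i p, l i p = (f i p.1, g i p.2)) ->
    (forall i p, l' i p = (f' i p.1, g' i p.2)) ->
    homotopic (chcomp f' f) (chid _) -> homotopic (chcomp g' g) (chid _) ->
    homotopic (chcomp l' l) (chid _).
  move=> ElE l'E /homotopicE[h hr hh] /homotopicE[h' hr' hh'].
  apply: (@homotopicI _ _ (csum X1 Y1) (csum X1 Y1) _ _
   (fun i j => pairl (h i j \o pr1 _ _)%VF (h' i j \o pr2 _ _)%VF)).
    by move=> i j; rhom_auto.
  move=> i [x y]; rewrite !csum_dE !lE /= l'E ElE ?lE /=.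
  have := hh i x; have := hh' i y; rewrite !lE => e1 e2.
  by apply: injective_projections.
move=> [f [f' [h1 h2]]] [g [g' [h3 h4]]].
have [l ElE] := mk _ _ _ _ f g; have [l' l'E] := mk _ _ _ _ f' g'.
exists l, l'; split; [exact: ht h1 h3|exact: ht h2 h4].
Qed.

Lemma isoT_csumC X Y : isoT (csum X Y) (csum Y X).
Proof.
have mk X1 X2 : exists l : chmap (csum X1 X2) (csum X2 X1),
    forall i p, l i p = (p.2, p.1).
  have [||l ElE] := @chmapI _ _ (csum X1 X2) (csum X2 X1)
    (fun i => pairl (pr2 _ _) (pr1 _ _)).
  - by move=> i; rhom_auto.
  - by move=> i x; rewrite !csum_dE !lE.
  by exists l => i p; rewrite ElE !lE.
have [f fE] := mk X Y; have [g gE] := mk Y X.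
by apply: (isoT_strict (f := f) (g := g)) => i [x y]; rewrite fE gE.
Qed.

End Shift.

Section Cones.
Variables (k : fieldType) (A : falgType k).
Implicit Types X Y Z W : cpx A.

(** Rotation: the cone of the inclusion of Y into cone f is X[1], by the
    projection (y, (x, y')) |-> x and the map x |-> (- f x, (x, 0)). *)
Lemma cone_cone_in X Y (f : chmap X Y) : isoT (cone (cone_in f)) (shift X 1).
Proof.
pose g := cone_in f.
have [||p pE] := @chmapI _ _ (cone g) (shift X 1)
  (fun i => pr1 (X (i + 1)) (Y i) \o pr2 (Y (i + 1)) (cone f i))%VF.
- by move=> i; apply: (@rhom_comp _ _ (cone g i) (cone f i)); rhom_auto.
- by move=> i x; rewrite !cone_dE shift1_dE !lE /= add0r.
have [||s sE] := @chmapI _ _ (shift X 1) (cone g)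
  (fun i => pairl (- f (i + 1)) (pairl \1 0))%VF.
- move=> i; apply: (@rhom_pairl _ _ (X (i + 1)) (Y (i + 1)) (cone f i)).
    by rhom_auto.
  by apply: (@rhom_pairl _ _ (X (i + 1)) (X (i + 1)) (Y i)); rhom_auto.
- move=> i x; rewrite !cone_dE shift1_dE !lE /=.
  rewrite linear0 addr0 !linearN /= opprK cm_commE; congr pair; rewrite ?opprK //.
  by apply: injective_projections; rewrite /= ?add0r ?addNr.
exists p, s; split; last first.
  by apply: homotopic_eq => i x; rewrite !lE pE sE !lE.
apply: homotopic_sym.
(* The homotopy is (y, (x, y')) |-> (y', 0). *)
apply: (@homotopicI _ _ (cone g) (cone g) _ _
  (fun i j => pairl (diag Y i (j + 1) \o pr2 (X (i + 1)) (Y i) \o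
       pr2 (Y (i + 1)) (cone f i)) 0)%VF).
  move=> i j; apply: (@rhom_pairl _ _ _ (Y (j + 1)) (cone f j)); last exact: rhom0.
  apply: (@rhom_comp _ _ (cone g i) (cone f i)); rhom_auto.
move=> i [y [x y']]; rewrite [chcomp _ _ _ _]comp_lfunE sE pE !cone_dE !lE !diag_id !lE /=.
apply: injective_projections; rewrite /= ?linear0 ?addr0 ?opprK.
  by rewrite (addrA y) [RHS]addrC addrK.
by apply: injective_projections; rewrite /= ?subrr ?subr0 ?addr0 ?add0r ?oppr0.
Qed.

End Cones.

Section ConeMaps.
Variables (k : fieldType) (A : falgType k).
Implicit Types X Y Z W : cpx A.

Lemma cd_cd0 X i j l x : j = i + 1 -> l = j + 1 -> cd X j l (cd X i j x) = 0.
Proof. by move=> e e'; rewrite -comp_lfunE cd_cd // lfunE. Qed.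

(** Subtracting d h + h d from a chain map gives a homotopic chain map. *)
Lemma homotopic_sub X Y (f : chmap X Y) (h : forall i j, 'Hom(X i, Y j)) :
  (forall i j, rhom (h i j)) ->
  exists2 g : chmap X Y, homotopic f g &
  forall i x, g (i + 1) x = f (i + 1) x -
     (cd Y i (i + 1) (h (i + 1) i x) +
      h (i + 1 + 1) (i + 1) (cd X (i + 1) (i + 1 + 1) x)).
Proof.
move=> hr.
pose b i := ((cd Y (i - 1) i \o h i (i - 1)) + (h (i + 1) i \o cd X i (i + 1)))%VF.
have bE i x : b (i + 1) x = cd Y i (i + 1) (h (i + 1) i x) +
      h (i + 1 + 1) (i + 1) (cd X (i + 1) (i + 1 + 1) x).
  rewrite /b !lE; congr (_ + _); pose j := i + 1 - 1.
  by rewrite -/j; have -> : j = i by rewrite /j addrK.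
have db i x : cd Y i (i + 1) (b i x) = cd Y i (i + 1) (h (i + 1) i (cd X i (i + 1) x)).
  by rewrite /b !lE linearD /= cd_cd0 ?subrK // add0r.
have br i : rhom (b i) by rewrite /b; rhom_auto.
clearbody b.
have [||g gE] := @chmapI _ _ X Y (fun i => f i - b i).
- by move=> i; apply: rhomD; [exact: (@cm_rhom _ _ _ _ f)|apply: rhomN].
- move=> i x; rewrite add_lfunE opp_lfunE bE cd_cdE linear0 addr0 !lE linearB /=.
  by rewrite cm_commE db.
exists g; last by move=> i x; rewrite gE add_lfunE opp_lfunE bE.
apply: homotopicI (hr) _ => i x; rewrite gE add_lfunE opp_lfunE bE.
by rewrite subKr.
Qed.

(** A chain endomorphism (x, y) |-> (x, y + k x) of a cone is invertible. *)
Lemma cone_unipotent X Y (f : chmap X Y) (c : chmap (cone f) (cone f))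
    (t : forall i, 'Hom(X (i + 1), Y i)) :
  (forall i x y, c i (x, y) = (x, y + t i x)) -> chiso c.
Proof.
move=> cE.
have tr i : rhom (t i).
  move=> a x; have := @cm_rhom _ _ _ _ c i a (x, 0).
  rewrite [ract (cone f i) a _]ract_sumE /= !cE ract_sumE /= => -[].
  by rewrite !linear0 !add0r.
have tc i x : t (i + 1) (cd X (i + 1) (i + 1 + 1) x) = - cd Y i (i + 1) (t i x).
  have := @cm_commE _ _ _ _ c i (x, 0).
  rewrite cone_dE !cE cone_dE /= => -[]; rewrite !linear0 linearN add0r addr0.
  by move=> /addrI => <-; rewrite opprK.
have [||c' c'E] := @chmapI _ _ (cone f) (cone f)
  (fun i => pairl (pr1 _ _) (pr2 _ _ - (t i \o pr1 _ _)))%VF.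
- by move=> i; rhom_auto.
- move=> i [x y]; rewrite !cone_dE !lE /= !linearB !linearN /= tc.
  by rewrite opprK addrA.
exists c'; split; apply: homotopic_eq => i [x y].
  by rewrite comp_lfunE cE c'E !lE /= addrK.
by rewrite comp_lfunE c'E !lE /= cE subrK.
Qed.

Lemma chiso_homotopic X Y (f g : chmap X Y) :
  homotopic f g -> chiso g -> chiso f.
Proof.
move=> fg [g' [h h']]; exists g'; split.
  by apply: homotopic_trans h; apply: homotopic_compl.
by apply: homotopic_trans h'; apply: homotopic_compr.
Qed.

(** An endomorphism of a cone that lies over endomorphisms homotopic to the
    identity is homotopic to a unipotent one. *)
Lemma cone_endo X Y (f : chmap X Y) (c : chmap (cone f) (cone f))
    (v : chmap X X) (w : chmap Y Y) (t : forall i, 'Hom(X (i + 1), Y i)) :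
  (forall i p, c i p = (v (i + 1) p.1, w i p.2 + t i p.1)) ->
  homotopic v (chid X) -> homotopic w (chid Y) -> chiso c.
Proof.
move=> cE /homotopicE[a ar ah] /homotopicE[b br bh].
(* With a and b homotopies from v and w to the identity, the homotopy
   (x, y) |-> (- a x, b y) removes the diagonal defects of c. *)
have [|g cg gE] := @homotopic_sub (cone f) (cone f) c (fun i j =>
  pairl (- a (i + 1) (j + 1) \o pr1 _ _) (b i j \o pr2 _ _))%VF.
  by move=> i j; rhom_auto.
apply: (chiso_homotopic cg).
have gx : forall i x, (g i (x, 0)).1 = x.
  apply: int_succ_ind => i x; rewrite gE !cone_dE !lE cE /=.
  have := ah (i + 1) x; rewrite [chid X _ _]lE => /eqP; rewrite subr_eq => /eqP ->.
  by rewrite !linearN /= !opprK [LHS]addrC addKr.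
have gy : forall i y, g i (0, y) = (0, y).
  apply: int_succ_ind => i y; rewrite gE !cone_dE !lE cE /=.
  have := bh i y; rewrite [chid Y _ _]lE => /eqP; rewrite subr_eq => /eqP ->.
  apply: injective_projections; rewrite /= !linear0 ?oppr0 ?linear0 ?addr0 ?subr0 ?add0r //.
  by rewrite [LHS]addrC addKr.
apply: (@cone_unipotent _ _ _ _ (fun i => pr2 _ _ \o g i \o in1 _ _)%VF) => i x y.
have -> : (x, y) = (x, 0) + (0, y) :> cone f i.
  by apply: injective_projections; rewrite /= ?addr0 ?add0r.
rewrite linearD /= gy !lE; apply: injective_projections; rewrite /= ?addr0 //.
by rewrite [LHS]addrC.
Qed.

(** A homotopy commutative square of isomorphisms induces an isomorphism of
    cones. *)
Lemma isoT_cone X Y X' Y' (f : chmap X Y) (f' : chmap X' Y') (v : chmap X X')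
    (w : chmap Y Y') :
  chiso v -> chiso w -> homotopic (chcomp w f) (chcomp f' v) ->
  isoT (cone f) (cone f').
Proof.
have mk X1 Y1 X2 Y2 (f1 : chmap X1 Y1) (f2 : chmap X2 Y2) (v1 : chmap X1 X2)
    (w1 : chmap Y1 Y2) : homotopic (chcomp w1 f1) (chcomp f2 v1) ->
    exists c : chmap (cone f1) (cone f2), exists t : forall i, 'Hom(X1 (i + 1), Y2 i),
    forall i p, c i p = (v1 (i + 1) p.1, w1 i p.2 + t i p.1).
  move=> /homotopicE[h hr hh].
  have [||c cE] := @chmapI _ _ (cone f1) (cone f2) (fun i =>
    pairl (v1 (i + 1) \o pr1 _ _) ((w1 i \o pr2 _ _) + (h (i + 1) i \o pr1 _ _)))%VF.
  - by move=> i; rhom_auto.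
  - move=> i [x y]; rewrite !cone_dE !lE /= !linearN !linearD /= !cm_commE.
    have := hh i x; rewrite !lE => /eqP; rewrite subr_eq => /eqP ->.
    have E (V : zmodType) (D H F U : V) : D + H + F + U - H = F + (U + D).
      by rewrite (addrC D) -!addrA addrC -!addrA addNr addr0 addrC -addrA.
    by rewrite E.
  by exists c, (fun i => h (i + 1) i) => i p; rewrite cE !lE.
move=> [v' [vv vv']] [w' [ww ww']] wf.
have fv : homotopic (chcomp w' f') (chcomp f v').
  apply: homotopic_trans (homotopic_compr _ (chcomp1l f)).
  apply: homotopic_trans (homotopic_compr _ (homotopic_compr _ ww)).
  apply: homotopic_trans (homotopic_sym (chcomp1r _)) _.
  apply: homotopic_trans (homotopic_compl _ (homotopic_sym vv')) _.
  apply: homotopic_trans (chcompA _ _ _) _.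
  apply: homotopic_trans (homotopic_compr _ (homotopic_sym (chcompA _ _ _))) _.
  apply: homotopic_trans
    (homotopic_compr _ (homotopic_compl _ (homotopic_sym wf))) _.
  by apply: homotopic_compr; apply: chcompA.
have [c [t cE]] := mk _ _ _ _ _ _ _ _ wf.
have [c' [t' c'E]] := mk _ _ _ _ _ _ _ _ fv.
exists c; apply: (@chiso_lr _ _ _ _ _ c' c').
  apply: (@cone_endo _ _ _ _ (chcomp v' v) (chcomp w' w)
    (fun i => (w' i \o t i) + (t' i \o v (i + 1)))%VF) => // i p.
  by rewrite !comp_lfunE cE c'E !lE /= linearD addrA.
apply: (@cone_endo _ _ _ _ (chcomp v v') (chcomp w w')
  (fun i => (w i \o t' i) + (t i \o v' (i + 1)))%VF) => // i p.
by rewrite !comp_lfunE c'E cE !lE /= linearD addrA.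
Qed.

End ConeMaps.

(** * Triangles, approximations and thick subcategories *)

Section Triangles.
Variables (k : fieldType) (A : falgType k).
Implicit Types X Y Z W M : cpx A.

(** The first vertex of a triangle is the shifted cone of its second map. *)
Lemma distinguished_cone N D X (a : chmap N D) (g : chmap D X)
    (b : chmap X (shift N 1)) :
  distinguished a g b -> isoT (cone g) (shift N 1).
Proof.
move=> [X' [Y' [f [u [v [w [[iu iv iw] _ h _]]]]]]].
apply: isoT_trans (isoT_cone iv iw h) _; apply: isoT_trans (cone_cone_in f) _.
by apply: isoT_shift; apply: isoT_sym; exists u.
Qed.

Lemma distinguished_std X Y (f : chmap X Y) :
  distinguished f (cone_in f) (cone_pr f).
Proof.
exists X, Y, f, (chid X), (chid Y), (chid (cone f)); split.
- by split; apply: chiso_id.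
- by apply: homotopic_eq => i x; rewrite !comp_lfunE !id_lfunE.
- by apply: homotopic_eq => i x; rewrite !comp_lfunE !id_lfunE.
- by apply: homotopic_eq => i x; rewrite !comp_lfunE !id_lfunE.
Qed.

(** If q : X -> Z is degreewise split with kernel Y, its cone is Y[1]: the maps
    y |-> (y, 0) and (x, z) |-> r (x + d s z) are inverse up to homotopy. *)
Lemma isoT_cone_split X Y Z (q : chmap X Z) (io : chmap Y X)
    (r : forall i, 'Hom(X i, Y i)) (s : forall i, 'Hom(Z i, X i)) :
  (forall i, rhom (r i)) -> (forall i, rhom (s i)) ->
  (forall i y, r i (io i y) = y) -> (forall i z, q i (s i z) = z) ->
  (forall i x, io i (r i x) + s i (q i x) = x) ->
  isoT (cone q) (shift Y 1).
Proof.
move=> rr sr rio qs E.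
have qio i y : q i (io i y) = 0.
  have := E i (io i y); rewrite rio -[RHS]addr0 => /addrI/(congr1 (q i)).
  by rewrite qs linear0.
have ior i x : io i (r i x) = x - s i (q i x) by rewrite -{2}(E i x) addrK.
have [||p pE] := @chmapI _ _ (cone q) (shift Y 1) (fun i =>
  ((r (i + 1) \o pr1 _ _) + (r (i + 1) \o cd X i (i + 1) \o s i \o pr2 _ _))%VF).
- by move=> i; rhom_auto.
- move=> i [x z]; rewrite cone_dE shift1_dE !lE /= !linearD /= !linearN /=.
  have e1 : r (i + 1 + 1) (cd X (i + 1) (i + 1 + 1) (s (i + 1) (q (i + 1) x))) =
      r (i + 1 + 1) (cd X (i + 1) (i + 1 + 1) x) -
      cd Y (i + 1) (i + 1 + 1) (r (i + 1) x).
    rewrite -{2}(E (i + 1) x) linearD linearD /= -cm_commE rio.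
    by rewrite [X in X - _]addrC addrK.
  have e2 : r (i + 1 + 1) (cd X (i + 1) (i + 1 + 1) (s (i + 1) (cd Z i (i + 1) z)))
      = - cd Y (i + 1) (i + 1 + 1) (r (i + 1) (cd X i (i + 1) (s i z))).
    have := cd_cdE (s i z); rewrite -{1}(E (i + 1) (cd X i (i + 1) (s i z))).
    rewrite linearD /= -(cm_commE io) (cm_commE q) qs => /(congr1 (r (i + 1 + 1))).
    by rewrite linearD /= rio linear0 => /eqP; rewrite addr_eq0 => /eqP ->; rewrite opprK.
  by rewrite e1 e2 !addrA addNr add0r.
have [||l ElE] := @chmapI _ _ (shift Y 1) (cone q) (fun i => pairl (io (i + 1)) 0).
- by move=> i; apply: (@rhom_pairl _ _ (Y (i + 1)) (X (i + 1)) (Z i)); rhom_auto.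
- move=> i y; rewrite cone_dE shift1_dE !lE /= qio linear0 addr0 linearN /=.
  by rewrite cm_commE.
exists p, l; split; last first.
  apply: homotopic_eq => i y; rewrite comp_lfunE pE ElE !lE /=.
  by rewrite rio !linear0 addr0.
apply: homotopic_sym.
(* The homotopy is (x, z) |-> (s z, 0). *)
apply: (@homotopicI _ _ (cone q) (cone q) _ _ (fun i j =>
   pairl (diag X i (j + 1) \o s i \o pr2 _ _) 0)%VF).
  move=> i j; apply: (@rhom_pairl _ _ _ (X (j + 1)) (Z j)); rhom_auto.
move=> i [x z]; rewrite [chcomp _ _ _ _]comp_lfunE ElE pE !cone_dE !lE !diag_id !lE /=.
rewrite linear0 addr0 qs; apply: injective_projections; rewrite /= ?addr0 ?subr0 //.
rewrite linearD /= !ior linearD /= !cm_commE qs.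
have Ez (V : zmodType) (u a b c : V) : u + (- (u - a) - (b - c)) = - b + (a + c).
  by rewrite !opprB addrA (addrC u) subrK [RHS]addrC addrA.
by rewrite [X in _ = _ + X]linearD Ez.
Qed.

(** Minimal right approximations are unique, and so are right mutations. *)
Lemma right_mutation_unique M X M' Y1 Y2 :
  right_mutation M X M' Y1 -> right_mutation M X M' Y2 -> isoT Y1 Y2.
Proof.
move=> [_ [N1 [D1 [a1 [g1 [b1 [[aD1 ap1] m1 t1 i1]]]]]]].
move=> [_ [N2 [D2 [a2 [g2 [b2 [[aD2 ap2] m2 t2 i2]]]]]]].
apply: isoT_trans i1 (isoT_trans _ (isoT_sym i2)).
apply: isoT_csum (isoT_refl _); apply: (@isoT_shift_inj _ _ _ _ 1).
apply: isoT_trans (isoT_sym (distinguished_cone t1)) _.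
apply: isoT_trans _ (distinguished_cone t2).
have [v hv] := ap2 _ g1 aD1; have [v' hv'] := ap1 _ g2 aD2.
have iv : chiso v.
  apply: (@chiso_lr _ _ _ _ _ v' v').
    apply: m1; apply: homotopic_trans (chcompA _ _ _) _.
    by apply: homotopic_trans hv; apply: homotopic_compr.
  apply: m2; apply: homotopic_trans (chcompA _ _ _) _.
  by apply: homotopic_trans hv'; apply: homotopic_compr.
apply: (isoT_cone iv (chiso_id X)).
by apply: homotopic_trans (chcomp1l _) (homotopic_sym hv).
Qed.

Section Thick.
Variables (S : cpx A -> Prop) (hS : thick S).

(** A thick subcategory containing the last two vertices of a triangle contains
    the first one. *)
Lemma thick_fst X Y (f : chmap X Y) : S Y -> S (cone f) -> S X.
Proof.
move=> sY sC; apply: (thick_iso hS (isoT_unshift X (addrN 1))).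
apply: (thick_shift hS); apply: (thick_iso hS (cone_cone_in f)).
exact: (thick_cone hS (distinguished_std (cone_in f))).
Qed.

Lemma thick_split X Y Z (q : chmap X Z) (io : chmap Y X)
    (r : forall i, 'Hom(X i, Y i)) (s : forall i, 'Hom(Z i, X i)) :
  (forall i, rhom (r i)) -> (forall i, rhom (s i)) ->
  (forall i y, r i (io i y) = y) -> (forall i z, q i (s i z) = z) ->
  (forall i x, io i (r i x) + s i (q i x) = x) ->
  S Y -> S Z -> S X.
Proof.
move=> rr sr rio qs E sY sZ; apply: (thick_fst (f := q)) => //.
apply: (thick_iso hS (isoT_sym (isoT_cone_split rr sr rio qs E))).
exact: (thick_shift hS).
Qed.

Lemma thick_csum X Y : S X -> S Y -> S (csum X Y).
Proof.
have [q qE] := chmap_pr2 X Y; have [io ioE] := chmap_in1 X Y.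
apply: (thick_split (q := q) (io := io) (r := fun i => pr1 _ _)
  (s := fun i => in2 _ _)).
- by move=> i; rhom_auto.
- by move=> i; rhom_auto.
- by move=> i x; rewrite ioE !biprodE.
- by move=> i x; rewrite qE !biprodE.
move=> i [x y]; rewrite ioE qE !biprodE.
by apply: injective_projections; rewrite /= ?addr0 ?add0r.
Qed.

Lemma thick_add M X : S M -> add_closure M X -> S X.
Proof.
move=> sM; elim=> {X} [||X Y _ sX _ sY|X Y _ sXY|X Y i _ sX] //.
- exact: thick_zero.
- exact: thick_csum.
- exact: (thick_summand hS sXY).
- exact: (thick_iso hS i).
Qed.

End Thick.

End Triangles.

(** * Submodules, retracts and the additive closure of a module *)

Section Submodules.
Variables (k : fieldType) (A : falgType k).
Implicit Types M N X Y : rmod A.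

Lemma ract0 M a : ract M a 0 = 0.
Proof. exact: linear0. Qed.

(** The inclusion of a submodule. *)
Definition subin M (U : {vspace M}) (hU : submodule U) : 'Hom(submod hU, M) :=
  linfun (@vsval _ _ U).

Lemma subinE M (U : {vspace M}) (hU : submodule U) x : subin hU x = vsval x.
Proof. by rewrite lfunE. Qed.

Lemma subin_rhom M (U : {vspace M}) (hU : submodule U) : rhom (subin hU).
Proof. by move=> a x; rewrite !subinE val_ract_submod. Qed.

(** The map f : N -> M regarded as a map into a submodule containing its image. *)
Definition corestr N M (U : {vspace M}) (hU : submodule U) (f : 'Hom(N, M)) :
    'Hom(N, submod hU) :=
  locked (linfun (@vsproj _ _ U) \o f)%VF.

Lemma corestrE N M (U : {vspace M}) (hU : submodule U) (f : 'Hom(N, M)) x :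
  f x \in U -> vsval (corestr hU f x) = f x.
Proof. by move=> fx; rewrite /corestr -lock comp_lfunE lfunE /= vsprojK. Qed.

Lemma corestr_rhom N M (U : {vspace M}) (hU : submodule U) (f : 'Hom(N, M)) :
  rhom f -> (forall x, f x \in U) -> rhom (corestr hU f).
Proof.
move=> hf fU a x; apply: val_inj.
by rewrite [LHS]corestrE // [RHS]val_ract_submod corestrE // hf.
Qed.

Lemma lker_submodule M N (f : 'Hom(M, N)) : rhom f -> submodule (lker f).
Proof. by move=> hf a x; rewrite !memv_ker hf => /eqP ->; rewrite ract0. Qed.

Lemma limg_submodule M N (f : 'Hom(M, N)) : rhom f -> submodule (limg f).
Proof.
move=> hf a x /memv_imgP[y _ ->]; apply/memv_imgP.
by exists (ract M a y); rewrite ?memvf // hf.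
Qed.

Lemma retract_projective (P Q : rmod A) (s : 'Hom(Q, P)) (r : 'Hom(P, Q)) :
  rhom s -> rhom r -> (forall x, r (s x) = x) -> projective P -> projective Q.
Proof.
move=> hs hr rs hP M N g f hg hf sg.
have [h hh gh] := hP _ _ g (f \o r)%VF hg (rhom_comp hf hr) sg.
exists (h \o s)%VF; first exact: rhom_comp.
apply/lfunP => x; have /lfunP/(_ (s x)) := gh.
by rewrite !comp_lfunE rs.
Qed.

Lemma limg_fullP M N (f : 'Hom(M, N)) :
  (forall y, exists x, f x = y) <-> limg f = fullv.
Proof.
split=> [h|h y].
  apply/eqP; rewrite eqEsubv subvf; apply/subvP => y _.
  by have [x <-] := h y; rewrite memv_img ?memvf.
by have /memv_imgP[x _ ->] : y \in limg f; [rewrite h memvf|exists x].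
Qed.

Lemma lker0_of_surj M (f : 'Hom(M, M)) : limg f = fullv -> lker f = 0%VS.
Proof.
move=> sf; apply/eqP; rewrite -dimv_eq0 -(eqn_add2r (\dim (limg f))).
by rewrite -{1}(capfv (lker f)) limg_ker_dim sf add0n.
Qed.

Lemma rhom_inv M N (f : 'Hom(M, N)) : rhom f -> lker f = 0%VS -> limg f = fullv ->
  exists g : 'Hom(N, M), [/\ rhom g, forall x, g (f x) = x & forall y, f (g y) = y].
Proof.
move=> hf kf sf; exists (f^-1)%VF.
have fK x : (f^-1)%VF (f x) = x by apply: lker0_lfunK; apply/eqP.
have Kf y : f ((f^-1)%VF y) = y by apply: limg_lfunVK; rewrite sf memvf.
by split=> // a y; rewrite -{1}(Kf y) -hf fK.
Qed.

(** The additive closure of a projective module M inside proj-A. *)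
Inductive madd (M : pmod A) : pmod A -> Prop :=
| madd_self : madd M M
| madd_zero : madd M (pzero A)
| madd_sum (P Q : pmod A) : madd M P -> madd M Q -> madd M (psum P Q)
| madd_retract (P Q : pmod A) (s : 'Hom(Q, P)) (r : 'Hom(P, Q)) : rhom s -> rhom r ->
    (forall x, r (s x) = x) -> madd M P -> madd M Q.

(** Finitely many elements in images of maps from M lie in the image of one map
    from a module of add M. *)
Lemma madd_gen (M : pmod A) X (xs : seq X) :
  (forall x, x \in xs -> exists2 g : 'Hom(M, X), rhom g & x \in limg g) ->
  exists2 R : pmod A, madd M R & exists2 r : 'Hom(R, X), rhom r &
  forall x, x \in xs -> x \in limg r.
Proof.
elim: xs => [|x xs IH] hxs.
  by exists (pzero A); [exact: madd_zero|exists 0; [exact: rhom0|]].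
have [y yxs|R mR [r hr rE]] := IH; first by apply: hxs; rewrite inE yxs orbT.
have [g hg gx] := hxs x (mem_head _ _).
exists (psum M R); first by apply: madd_sum => //; apply: madd_self.
exists (copairl g r); first exact: rhom_copairl.
move=> y; rewrite inE => /orP[/eqP ->|/rE].
  have /memv_imgP[m _ ->] := gx; apply/memv_imgP; exists (m, 0); first exact: memvf.
  by rewrite !lE /= linear0 addr0.
move=> /memv_imgP[m _ ->]; apply/memv_imgP; exists (0, m); first exact: memvf.
by rewrite !lE /= linear0 add0r.
Qed.

(** A projective quotient of a module of add M is in add M. *)
Lemma madd_cover (M R Q : pmod A) (r : 'Hom(R, Q)) :
  madd M R -> rhom r -> limg r = fullv -> madd M Q.
Proof.
move=> mR hr sr.
have [s hs rs] := @pmod_projective _ _ Q _ _ r \1%VF hr (@rhom1 _ _ _) sr.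
apply: (madd_retract hs hr _ mR) => x.
by have /lfunP/(_ x) := rs; rewrite !lE.
Qed.

Lemma madd_regmod (Q : pmod A) : madd (pA A) Q.
Proof.
have [x _|R mR [r hr rE]] := @madd_gen (pA A) Q (vbasis {:Q}).
  have h0_lin : linear (fun a : A => ract Q a x).
    by move=> c a b; rewrite (ract_linear Q) add_lfunE scale_lfunE.
  exists (mklin h0_lin : 'Hom(pA A, Q)).
    by move=> a b; rewrite [LHS]mklinE [X in _ = ract Q a X]mklinE /= lfunE /= ractM.
  by apply/memv_imgP; exists (1 : A); rewrite ?memvf // mklinE ract1.
apply: (madd_cover mR hr); apply/eqP; rewrite eqEsubv subvf /=.
rewrite -(span_basis (vbasisP {:Q})); apply/span_subvP => x xb; exact: rE.
Qed.

End Submodules.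

Arguments subin_rhom {k A M U} hU.

(** * Stalk complexes *)

Section Stalks.
Variables (k : fieldType) (A : falgType k).
Implicit Types (X Y : cpx A) (P Q R : pmod A).

(** The complex X is concentrated in degree 0. *)
Definition conc0 X : Prop := forall i, i != 0 -> forall x : X i, x = 0.

Lemma conc0_stalk P : conc0 (stalk P).
Proof. by move=> [[|i]|i] // _ x; apply/rowP; case. Qed.

Lemma conc0_csum X Y : conc0 X -> conc0 Y -> conc0 (csum X Y).
Proof. by move=> hX hY i i0 [x y]; rewrite (hX i i0 x) (hY i i0 y). Qed.

(** The map of graded modules that is f in degree 0 and zero elsewhere. *)
Definition deg0_map X Y (f : 'Hom(X 0, Y 0)) i : 'Hom(X i, Y i) :=
  match i return 'Hom(X i, Y i) with Posz 0 => f | _ => 0 end.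

Lemma conc0_chmap X Y (f : 'Hom(X 0, Y 0)) :
  conc0 X -> conc0 Y -> rhom f -> exists F : chmap X Y, F 0 = f.
Proof.
move=> hX hY hf.
have hr i : rhom (deg0_map f i) by case: i => [[|i]|i] //=; apply: rhom0.
have hc i j : j = i + 1 ->
    (deg0_map f j \o cd X i j = cd Y i j \o deg0_map f i)%VF.
  move=> ->; apply/lfunP => x; rewrite !comp_lfunE.
  have [i0|i0] := eqVneq i 0; last by rewrite (hX i i0 x) !linear0.
  have i1 : i + 1 != 0 by rewrite i0.
  by rewrite (hY _ i1 (cd Y i (i + 1) _)) (hY _ i1 (deg0_map _ _ _)).
by exists (ChMap hr hc).
Qed.

Lemma conc0_iso X Y (f : 'Hom(X 0, Y 0)) (g : 'Hom(Y 0, X 0)) :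
  conc0 X -> conc0 Y -> rhom f -> rhom g ->
  (forall x, g (f x) = x) -> (forall y, f (g y) = y) -> isoT X Y.
Proof.
move=> hX hY hf hg gf fg.
have [F FE] := conc0_chmap hX hY hf; have [G GE] := conc0_chmap hY hX hg.
apply: (isoT_strict (f := F) (g := G)) => i x.
  have [i0|i0] := eqVneq i 0; last by rewrite (hX i i0 x) !linear0.
  by subst i; rewrite FE GE.
have [i0|i0] := eqVneq i 0; last by rewrite (hY i i0 x) !linear0.
by subst i; rewrite FE GE.
Qed.

Lemma conc0_isoT_stalk X : conc0 X -> isoT X (stalk (X 0)).
Proof.
move=> hX; apply: (@conc0_iso X (stalk (X 0)) \1%VF \1%VF) => //.
- exact: conc0_stalk.
- exact: rhom1.
- exact: rhom1.
- by move=> x; rewrite !lE.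
- by move=> x; rewrite !lE.
Qed.

Lemma isoT_zero X Y : (forall i (x : X i), x = 0) -> (forall i (y : Y i), y = 0) ->
  isoT X Y.
Proof.
move=> hX hY; apply: (isoT_strict (f := chzero X Y) (g := chzero Y X)) => i x.
  by rewrite [LHS]hX [RHS]hX.
by rewrite [LHS]hY [RHS]hY.
Qed.

Lemma stalk_psum P Q : isoT (stalk (psum P Q)) (csum (stalk P) (stalk Q)).
Proof.
apply: (@conc0_iso (stalk (psum P Q)) (csum (stalk P) (stalk Q)) \1%VF \1%VF).
- exact: conc0_stalk.
- by apply: conc0_csum; apply: conc0_stalk.
- exact: rhom1.
- exact: rhom1.
- by move=> x; rewrite !lE.
- by move=> x; rewrite !lE.
Qed.

(** The complement of a retract Q of P is the kernel of the retraction. *)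
Lemma stalk_retract P Q (s : 'Hom(Q, P)) (r : 'Hom(P, Q)) :
  rhom s -> rhom r -> (forall x, r (s x) = x) ->
  exists K, isoT (stalk P) (csum (stalk Q) (stalk K)).
Proof.
move=> hs hr rs; have hK := lker_submodule hr.
pose q : 'Hom(P, P) := (\1 - (s \o r))%VF.
have qE x : q x = x - s (r x) by rewrite /q !lE.
have qK x : q x \in lker r by rewrite memv_ker qE linearB /= rs subrr.
have hq : rhom q by rewrite /q; rhom_auto.
have hqr := corestr_rhom hK hq qK.
have pK : projective (submod hK).
  apply: (retract_projective (subin_rhom hK) hqr _ (@pmod_projective _ _ P)).
  move=> x; apply: val_inj; rewrite [LHS]corestrE // qE subinE.
  by have /eqP -> : r (vsval x) == 0; [rewrite -memv_ker subvsP|rewrite linear0 subr0].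
exists (PMod pK).
apply: isoT_trans (stalk_psum Q (PMod pK)).
apply: (@conc0_iso (stalk P) (stalk (psum Q (PMod pK)))
  (pairl r (corestr hK q)) (copairl s (subin hK))).
- exact: conc0_stalk.
- exact: conc0_stalk.
- exact: (@rhom_pairl _ _ P Q (submod hK)).
- by apply: (@rhom_copairl _ _ P Q (submod hK)) => //; apply: subin_rhom.
- by move=> x; rewrite copairlE pairlE subinE corestrE // qE addrC subrK.
move=> [x y]; rewrite copairlE pairlE [(_, _).1]/= [(_, _).2]/= subinE linearD /= rs.
have /eqP ry : r (vsval y) == 0 by rewrite -memv_ker subvsP.
rewrite ry addr0; congr pair; apply: val_inj.
by rewrite [LHS]corestrE // qE linearD /= rs ry addr0 addrC addKr.
Qed.

Lemma stalk_madd P Q : madd P Q -> add_closure (stalk P) (stalk Q).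
Proof.
elim=> {Q} [||Q R _ aQ _ aR|R Q s r hs hr rs _ aR].
- exact: add_self.
- apply: add_iso (add_zero _); apply: isoT_zero => [i x|[[|i]|i] x]; apply/rowP; by case.
- by apply: add_iso (isoT_sym (stalk_psum Q R)) _; apply: add_sum.
have [K iK] := stalk_retract hs hr rs.
by apply: add_summand (add_iso iK aR).
Qed.

End Stalks.

(** * The regular module generates *)

Section Generation.
Variables (k : fieldType) (A : falgType k).
Implicit Types (X Y : cpx A) (P Q R : pmod A).

(** The module P if c holds and 0 otherwise, with the maps to and from P. *)
Definition cut (c : bool) P : pmod A := if c then P else pzero A.

Definition cut_in c P : 'Hom(cut c P, P) :=
  match c return 'Hom(cut c P, P) with true => \1%VF | false => 0 end.

Definition cut_pr c P : 'Hom(P, cut c P) :=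
  match c return 'Hom(P, cut c P) with true => \1%VF | false => 0 end.

Lemma cut_in_rhom c P : rhom (cut_in c P).
Proof. by case: c; [apply: rhom1|apply: rhom0]. Qed.

Lemma cut_pr_rhom c P : rhom (cut_pr c P).
Proof. by case: c; [apply: rhom1|apply: rhom0]. Qed.

Lemma cut_inK c P x : cut_pr c P (cut_in c P x) = x.
Proof. by case: c x => x; rewrite !lE //; apply/rowP; case. Qed.

Lemma cut_prK c P x : cut_in c P (cut_pr c P x) = if c then x else 0.
Proof. by case: c; rewrite !lE. Qed.

Lemma cut0 c P (x : cut c P) : ~~ c -> x = 0.
Proof. by case: c x => // x _; apply/rowP; case. Qed.

(** The components of X in the degrees satisfying b. *)
Definition trunc (b : int -> bool) X : cpx A.
Proof.
refine (@Cpx _ _ (fun i => cut (b i) (X i))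
  (fun i j => (cut_pr (b j) (X j) \o cd X i j \o cut_in (b i) (X i))%VF) _ _ _).
- move=> i j; apply: rhom_comp (@cut_in_rhom _ _).
  by apply: rhom_comp (@cut_pr_rhom _ _) _; apply: cd_rhom.
- move=> i j l ej el; apply/lfunP => x; rewrite !comp_lfunE lfun0E cut_prK.
  by case: (b j); rewrite ?linear0 // cd_cd0 // linear0.
- have [N hN] := cbounded X; exists N => i /hN h x.
  have := h (cut_in _ _ x); move=> /(congr1 (cut_pr (b i) _)).
  by rewrite cut_inK linear0.
Defined.

Lemma trunc_dE b X i j x : cd (trunc b X) i j x =
  cut_pr (b j) (X j) (cd X i j (cut_in (b i) (X i) x)).
Proof. by rewrite /= !comp_lfunE. Qed.

Arguments trunc : simpl never.

Section Thick.
Variables (S : cpx A -> Prop) (hS : thick S).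

(** If b is closed under increasing degrees, the components satisfying b form a
    subcomplex, and the others the quotient. *)
Lemma thick_trunc (b : int -> bool) X : (forall i, b i -> b (i + 1)) ->
  S (trunc b X) -> S (trunc (fun i => ~~ b i) X) -> S X.
Proof.
move=> bS; pose Y := trunc b X; pose Z := trunc (fun i => ~~ b i) X.
have [||q qE] := @chmapI _ _ X Z (fun i => cut_pr (~~ b i) (X i)).
- by move=> i; apply: cut_pr_rhom.
- move=> i x; rewrite trunc_dE cut_prK.
  have := bS i; case: (b i) => //= -> //.
  by rewrite !lE.
have [||io ioE] := @chmapI _ _ Y X (fun i => cut_in (b i) (X i)).
- by move=> i; apply: cut_in_rhom.
- move=> i x; rewrite trunc_dE cut_prK.
  have := bS i; move: x; rewrite /Y /trunc /=; case: (b i) => x //= bi.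
    by rewrite bi.
  by rewrite lE linear0 if_same.
apply: (thick_split hS (q := q) (io := io) (r := fun i => cut_pr (b i) (X i))
  (s := fun i => cut_in (~~ b i) (X i))).
- by move=> i; apply: cut_pr_rhom.
- by move=> i; apply: cut_in_rhom.
- by move=> i y; rewrite ioE cut_inK.
- by move=> i z; rewrite qE cut_inK.
by move=> i x; rewrite ioE qE !cut_prK; case: (b i); rewrite ?addr0 ?add0r.
Qed.

(** A complex concentrated in degree m is a shifted stalk complex. *)
Lemma thick_conc (m : int) X : S (stalk (pA A)) ->
  (forall i, i != m -> forall x : X i, x = 0) -> S X.
Proof.
move=> sA hX; apply: (thick_iso hS (isoT_unshift X (subrr m))).
apply: (thick_shift hS).
have h0 : conc0 (shift X m) by move=> i i0 x; apply: hX; lia.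
apply: (thick_iso hS (isoT_sym (conc0_isoT_stalk h0))).
by apply: (thick_add hS sA); apply: stalk_madd; apply: madd_regmod.
Qed.

Lemma thick_all : S (stalk (pA A)) -> forall X, S X.
Proof.
move=> sA X; have [N hN] := cbounded X.
(* Induction on the length n of an interval [m, m + n[ containing the support. *)
suff gen : forall (n : nat) (m : int) X,
    (forall i, (i < m) || (m + n%:Z <= i) -> forall x : X i, x = 0) -> S X.
  by apply: (gen (N + N).+1 (- N%:Z)) => i hi; apply: hN; lia.
clear X N hN; elim=> [|n IH] m X hX.
  apply: (thick_iso hS _ (thick_zero hS)); apply: isoT_zero => i x.
    by apply/rowP; case.
  by apply: hX; lia.
apply: (@thick_trunc (fun i => m + 1 <= i)%R) => [i /=||]; first by lia.
  apply: (IH (m + 1)) => i hi x.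
  have [b|b] := boolP (m + 1 <= i)%R; last exact: cut0.
  have := hX i; move: x; rewrite /trunc /= b /=; move=> x; apply; lia.
apply: (@thick_conc m) => // i im x.
have [b|b] := boolP (m + 1 <= i)%R; first by apply: cut0; rewrite negbK.
have := hX i; move: x; rewrite /trunc /= b /=; move=> x; apply; lia.
Qed.

End Thick.

End Generation.

(** * Complexes concentrated in degrees 0 and 1 *)

Section TwoDegrees.
Variables (k : fieldType) (A : falgType k).
Implicit Types (X Y : cpx A).

Lemma hom_zero_deg X Y :
  (forall i, (forall x : X i, x = 0) \/ (forall y : Y i, y = 0)) -> hom_zero X Y.
Proof.
move=> h f; apply: homotopic_eq => i x.
by have [h0|h0] := h i; [rewrite (h0 x) !linear0|rewrite [LHS]h0 [RHS]h0].
Qed.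

(** The complex X is concentrated in degrees 0 and 1. *)
Definition conc01 X : Prop :=
  forall i, i != 0 -> i != 1 -> forall x : X i, x = 0.

Lemma hom_zero_conc01 X n : conc01 X -> n != 0 -> n != 1 -> n != - 1 ->
  hom_zero X (shift X n).
Proof.
move=> hX n0 n1 n2; apply: hom_zero_deg => i.
have [i0|i0] := eqVneq i 0; first by right=> y; apply: hX; lia.
have [i1|i1] := eqVneq i 1; first by right=> y; apply: hX; lia.
by left; apply: hX.
Qed.

(** A chain map X -> X[1] is a map X^0 -> X^1, and is homotopic to zero as soon
    as that map factors through the differential. *)
Lemma hom_zero_shift1 X : conc01 X ->
  (forall f : 'Hom(X 0, X 1), rhom f ->
    exists2 h : 'Hom(X 0, X 0), rhom h & forall x, cd X 0 1 (h x) = f x) ->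
  hom_zero X (shift X 1).
Proof.
move=> hX hf F.
have [h hr hE] := hf (F 0) (@cm_rhom _ _ _ _ F 0).
pose H (i j : int) : 'Hom(X i, shift X 1 j) :=
  match i, j return 'Hom(X i, shift X 1 j) with
  | Posz 0, Negz 0 => - h | _, _ => 0 end.
apply: (@homotopicI _ _ _ _ _ _ H).
  by move=> [[|i]|i] [j|[|j]]; rewrite /H; (try exact: rhom0); apply: rhomN.
move=> i x; have [i0|i0] := eqVneq (i + 1) 0.
  have ei : i = - 1 by lia.
  subst i.
  have E2 : forall z : X (- 1 + 1 + 1), H (- 1 + 1 + 1) (- 1 + 1) z = 0.
    by move=> z; rewrite /H /= lE.
  rewrite E2 addr0 shift1_dE.
  have -> : H (- 1 + 1) (- 1) x = (- h) x by [].
  have -> : chzero X (shift X 1) (- 1 + 1) x = 0 by exact: lfun0E.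
  rewrite opp_lfunE linearN /= opprK.
  by apply: etrans (subr0 _) _; symmetry; exact: hE.
have [i1|i1] := eqVneq (i + 1) 1.
  have hz (y : shift X 1 (i + 1)) : y = 0 by apply: hX; lia.
  by rewrite [LHS]hz [RHS]hz.
by rewrite (hX _ i0 i1 x) !linear0 ?subr0 ?addr0.
Qed.

(** A chain map X -> X[-1] is a map X^1 -> X^0 annihilated by the differential on
    both sides, and there are no nonzero homotopies. *)
Lemma hom_zero_shiftN1 X : conc01 X ->
  (hom_zero X (shift X (- 1)) <->
   forall f : 'Hom(X 1, X 0), rhom f -> (forall x, f (cd X 0 1 x) = 0) ->
     (forall x, cd X 0 1 (f x) = 0) -> f = 0).
Proof.
move=> hX; split=> [hz f hf fd df|hz F]; last first.
  have F10 : (F 1 : 'Hom(X 1, X 0)) = 0.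
    apply: hz => [|x|x].
    - exact: (@cm_rhom _ _ _ _ F 1).
    - have := @cm_commE _ _ _ _ F 0 x; rewrite -[0 + 1 : int]/(1 : int) => ->.
      have -> : F 0 x = 0 by apply: hX.
      exact: linear0.
    - have := @cm_commE _ _ _ _ F 1 x.
      have -> : cd X 1 (1 + 1) x = 0 by apply: hX.
      rewrite linear0 shift_dE => /esym/eqP; rewrite scaler_eq0.
      have /negPf -> : (- 1 : k) ^ (- 1) != 0.
        by rewrite expfz_neq0 // oppr_eq0 oner_eq0.
      by move=> /eqP.
  apply: homotopic_eq => i x; have [i0|i0] := eqVneq i 0.
    by subst i; rewrite [LHS]hX // [RHS]hX.
  have [i1|i1] := eqVneq i 1; last by rewrite (hX _ i0 i1 x) !linear0.
  by subst i; rewrite F10 !lE.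
pose G (i : int) : 'Hom(X i, shift X (- 1) i) :=
  match i return 'Hom(X i, shift X (- 1) i) with Posz 1 => f | _ => 0 end.
have [||F FE] := @chmapI _ _ X (shift X (- 1)) G.
- by move=> [[|[|i]]|i]; rewrite /G; (try exact: rhom0); exact: hf.
- move=> i x; have [i0|i0] := eqVneq i 0.
    by subst i; rewrite [G 0 x]lfun0E linear0; exact: fd.
  have [i1|i1] := eqVneq i 1; last by rewrite (hX _ i0 i1 x) !linear0.
  subst i; have -> : cd X 1 (1 + 1) x = 0 by apply: hX.
  rewrite linear0 shift_dE.
  have -> : cd X (1 + - 1) (1 + 1 + - 1) (G 1 x) = 0 by exact: df.
  by rewrite scaler0.
have /homotopicE[h hr hh] := hz F; apply/lfunP => x.
rewrite lfun0E -[LHS]subr0.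
have -> : f x - 0 = F (0 + 1) x - chzero X (shift X (- 1)) (0 + 1) x.
  by rewrite FE; congr (_ - _); rewrite [RHS]lfun0E.
rewrite hh.
have -> : h (0 + 1) 0 x = 0 by apply: hX.
have -> : cd X (0 + 1) (0 + 1 + 1) x = 0 by apply: hX.
by rewrite !linear0 addr0.
Qed.

End TwoDegrees.

(** * The modules eA and eA(1-e)A *)

Section IdempotentModules.
Variables (k : fieldType) (A : falgType k).
Implicit Types (X : rmod A).

Lemma regmodE a (x : A) : ract (regmod A) a x = x * a.
Proof. by rewrite /= lfunE. Qed.

Lemma rideal_val_ract (U : {vspace A}) a (x : rideal U) :
  vsval (ract (rideal U) a x) = vsval x * a.
Proof. by rewrite [LHS]val_ract_submod regmodE. Qed.

Section OneIdempotent.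
Variables (e : A) (he : e * e = e).

Lemma mem_eA x : (x \in (<[e]> * fullv)%VS) = (e * x == x).
Proof.
apply/idP/eqP => [/eA_mem -> //|<-].
by rewrite memv_mul ?memv_line ?memvf.
Qed.

Lemma eA_val (x : eA e) : e * vsval x = vsval x.
Proof. by apply/eqP; rewrite -mem_eA subvsP. Qed.

(** The generator e of the module eA. *)
Definition eA_gen : eA e := vsproj _ e.

Lemma eA_genE : vsval eA_gen = e.
Proof. by rewrite vsprojK // mem_eA he. Qed.

Lemma eA_gen_ract (x : eA e) : ract (eA e) (vsval x) eA_gen = x.
Proof. by apply: val_inj; rewrite [LHS]rideal_val_ract eA_genE eA_val. Qed.

Lemma eA_gen_id : ract (eA e) e eA_gen = eA_gen.
Proof. by have := eA_gen_ract eA_gen; rewrite eA_genE. Qed.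

(** The map eA -> X sending e to x e. *)
Lemma eA_hom X (x : X) :
  exists2 f : 'Hom(eA e, X), rhom f & forall y, f y = ract X (vsval y) x.
Proof.
have hl : linear (fun y : eA e => ract X (vsval y) x).
  by move=> c y z; rewrite linearP /= (ract_linear X) add_lfunE scale_lfunE.
exists (mklin hl) => [a y|y]; last by rewrite mklinE.
by rewrite [LHS]mklinE [X in _ = ract _ a X]mklinE rideal_val_ract ractM.
Qed.

(** A module generated by its elements x e is a quotient of a module in
    add eA. *)
Lemma madd_peA X :
  (forall U : {vspace X}, submodule U -> (forall x, ract X e x \in U) ->
    U = fullv) ->
  exists2 R : pmod A, madd (peA he) R &
  exists2 r : 'Hom(R, X), rhom r & limg r = fullv.
Proof.
move=> hX.
have [x|R mR [r hr rE]] :=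
  @madd_gen _ _ (peA he) X [seq ract X e x | x <- vbasis {:X}].
  move=> /mapP[y _ ->]; have [g hg gE] := eA_hom y; exists g => //.
  by apply/memv_imgP; exists eA_gen; rewrite ?memvf // gE eA_genE.
exists R => //; exists r => //; apply: hX; first exact: limg_submodule.
move=> x; rewrite (coord_vbasis (memvf x)) linear_sum.
apply: rpred_sum => i _; rewrite linearZ; apply: rpredZ; apply: rE.
by apply: map_f; apply: mem_nth; rewrite size_tuple.
Qed.

End OneIdempotent.

Section Cover.
Variables (e : A) (he : e * e = e) (P : projcover (eAe'A e)).
Let he' := idem_compl he.

Lemma mem_eAe'A (x : eA e) :
  (x \in eAe'A_in_eA e) = (vsval x \in eAe'A_space e).
Proof. by rewrite -memv_preim lfunE. Qed.

Lemma mul_ee' : e * (1 - e) = 0.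
Proof. by rewrite mulrBr mulr1 he subrr. Qed.

Lemma mul_e'e : (1 - e) * e = 0.
Proof. by rewrite mulrBl mul1r he subrr. Qed.

Lemma memv_eAe'A a b : e * a * (1 - e) * b \in eAe'A_space e.
Proof. by rewrite !memv_mul ?memvf ?memv_line. Qed.

(** The projective cover of eA(1-e)A is in add (1-e)A. *)
Lemma projcover_madd : madd (peA he') P.
Proof.
have [|R mR [r hr sr]] := @madd_peA _ he' (eAe'A e).
  move=> U hU hx; apply/eqP; rewrite eqEsubv subvf; apply/subvP => x _.
  pose V := (linfun (@vsval _ _ (eAe'A_space e)) @: U)%VS.
  have: vsval x \in V.
    suff: (eAe'A_space e <= V)%VS by move=> /subvP; apply; apply: subvsP.
    apply/prodvP => u v hu _; have uS : u \in eAe'A_space e.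
      by rewrite -[u]mulr1 memv_mul ?memvf.
    apply/memv_imgP; exists (ract (eAe'A e) v (ract (eAe'A e) (1 - e) (vsproj _ u))).
      by apply: hU; apply: hx.
    rewrite lfunE /= !rideal_val_ract vsprojK //; congr (_ * _).
    have ulin : u \in lker (amulr (1 - e) - \1%VF).
      move: (u) hu; apply/subvP; apply/prodvP => w z _ /vlineP[c ->].
      rewrite memv_ker !lE lfunE /= -mulrA -scalerAl he' subrr //.
    by move: ulin; rewrite memv_ker !lE lfunE /= subr_eq0 => /eqP.
  by move=> /memv_imgP[y yU]; rewrite lfunE /= => /val_inj ->.
have [h hh hE] := @pmod_projective _ _ R _ _ _ _ (@pc_rhom _ _ _ P) hr (@pc_surj _ _ _ P).
apply: (madd_cover mR hh).
apply: (@pc_superfluous _ _ _ P _ (limg_submodule hh)); apply/eqP; rewrite eqEsubv subvf.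
apply/subvP => x _.
have /memv_imgP[y _ ey] : pc_map P x \in limg r by rewrite sr memvf.
rewrite -(subrK (h y) x) addrC memv_add ?memv_img ?memvf // memv_ker linearB /=.
by rewrite -[pc_map P (h y)]comp_lfunE hE ey subrr.
Qed.

(** Maps from add (1-e)A to eA take their values in eA(1-e)A. *)
Lemma madd_trace (R : pmod A) (f : 'Hom(R, eA e)) :
  madd (peA he') R -> rhom f -> forall x, f x \in eAe'A_in_eA e.
Proof.
move=> mR; elim: mR f => {R} [||R Q _ hR _ hQ|R Q s r hs hr rs _ hR] f hf x.
- rewrite mem_eAe'A -(eA_gen_ract he' x) hf -(eA_gen_id he') hf.
  rewrite !rideal_val_ract.
  by rewrite -(eA_val he (f _)) memv_eAe'A.
- have -> : x = 0 by apply/rowP; case.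
  by rewrite linear0 mem0v.
- have -> : x = in1 _ _ (pr1 _ _ x) + in2 _ _ (pr2 _ _ x).
    by rewrite !lE; apply: injective_projections; rewrite /= ?addr0 ?add0r.
  rewrite linearD /= -![f _]comp_lfunE; apply: memvD.
    by apply: hR; apply: rhom_comp => //; apply: rhom_in1.
  by apply: hQ; apply: rhom_comp => //; apply: rhom_in2.
- rewrite -(rs x) -[f _]comp_lfunE; apply: hR; exact: rhom_comp.
Qed.

Lemma p_eE x : vsval (p_e he P x) = vsval (pc_map P x).
Proof. by rewrite comp_lfunE [LHS]val_eAe'A_incl. Qed.

Lemma p_e_trace x : p_e he P x \in eAe'A_in_eA e.
Proof. by rewrite mem_eAe'A p_eE; apply: subvsP. Qed.

Lemma p_e_onto (y : eA e) : y \in eAe'A_in_eA e -> exists x, p_e he P x = y.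
Proof.
rewrite mem_eAe'A => yU.
have /memv_imgP[x _ ex] : (vsproj _ (vsval y) : eAe'A e) \in limg (pc_map P).
  by rewrite pc_surj memvf.
by exists x; apply: val_inj; rewrite [LHS]p_eE -ex vsprojK.
Qed.

(** Every map from add (1-e)A to eA factors through p_e. *)
Lemma madd_lift (R : pmod A) (f : 'Hom(R, eA e)) :
  madd (peA he') R -> rhom f ->
  exists2 h : 'Hom(R, P), rhom h & forall x, p_e he P (h x) = f x.
Proof.
move=> mR hf; have fU := madd_trace mR hf.
pose f1 : 'Hom(R, regmod A) := (subin (@rideal_submodule _ _ <[e]>) \o f)%VF.
have f1E x : f1 x = vsval (f x) by rewrite /f1 comp_lfunE subinE.
have hf1 : rhom f1 by apply: rhom_comp hf; apply: subin_rhom.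
have f1U x : f1 x \in eAe'A_space e by rewrite f1E -mem_eAe'A.
pose f2 : 'Hom(R, eAe'A e) :=
  corestr (@rideal_submodule _ _ (<[e]> * fullv * <[1 - e]>)%VS) f1.
have hf2 : rhom f2 by apply: corestr_rhom.
have [h hh hE] := @pmod_projective _ _ R _ _ _ _ (@pc_rhom _ _ _ P) hf2 (@pc_surj _ _ _ P).
exists h => // x; apply: val_inj; rewrite [LHS]p_eE.
by rewrite -[pc_map P (h x)]comp_lfunE hE [LHS]corestrE.
Qed.

(** If (1-e)A receives no nonzero map from eA that kills eA(1-e)A, neither does
    any module of add (1-e)A. *)
Lemma madd_kill (R : pmod A) :
  (forall f : 'Hom(eA_mod_eAe'A e, eA (1 - e)), rhom f -> f = 0) ->
  madd (peA he') R -> forall f : 'Hom(eA e, R), rhom f ->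
  (forall x, x \in eAe'A_in_eA e -> f x = 0) -> f = 0.
Proof.
move=> h0 mR; elim: mR => {R} [||R Q _ hR _ hQ|R Q s r hs hr rs _ hR] f hf fk.
- pose hU := @eAe'A_in_eA_submodule _ _ e.
  have fd x : f (daddv_pi (eAe'A_in_eA e)^C (eAe'A_in_eA e) x) = f x.
    have /fk := sub_daddv_piC (eAe'A_in_eA e) x.
    by rewrite linearB => /eqP; rewrite subr_eq0 => /eqP.
  pose g : 'Hom(eA_mod_eAe'A e, eA (1 - e)) :=
    (f \o linfun (@vsval _ _ ((eAe'A_in_eA e)^C)%VS))%VF.
  have gE x : g (quotpi hU x) = f x.
    by rewrite /g comp_lfunE -(fd x) -(val_quotpi hU); congr (f _); apply: lfunE.
  have sq y : exists x, quotpi hU x = y.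
    by have /limg_fullP/(_ y) := quotpi_surj hU.
  have g0 : g = 0.
    apply: h0 => a y; have [x <-] := sq y.
    by rewrite -(quotpi_rhom hU) !gE hf.
  by apply/lfunP => x; rewrite -gE g0 !lE.
- by apply/lfunP => x; apply/rowP; case.
- have f1 : (pr1 R Q \o f)%VF = 0.
    apply: hR => [|x xU]; first by apply: rhom_comp hf; apply: rhom_pr1.
    by rewrite comp_lfunE fk // linear0.
  have f2 : (pr2 R Q \o f)%VF = 0.
    apply: hQ => [|x xU]; first by apply: rhom_comp hf; apply: rhom_pr2.
    by rewrite comp_lfunE fk // linear0.
  apply/lfunP => x; have /lfunP/(_ x) := f1; have /lfunP/(_ x) := f2.
  by rewrite !lE => e2 e1; apply: injective_projections.
have sf : (s \o f)%VF = 0.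
  apply: hR => [|x xU]; first exact: rhom_comp.
  by rewrite comp_lfunE fk // linear0.
apply/lfunP => x; rewrite -(rs (f x)) -[s _]comp_lfunE sf !lE linear0 //.
Qed.

End Cover.
End IdempotentModules.

(** * The Okuyama-Rickard complex *)

Section OkuyamaRickard.
Variables (k : fieldType) (A : falgType k).
Variables (e : A) (he : e * e = e) (P : projcover (eAe'A e)).
Let he' := idem_compl he.
Let p := p_e he P.
Let hp : rhom p := @p_e_rhom _ _ _ he P.
Let N := two_term hp.
Let D := stalk P.
Let X := stalk (peA he).
Let M' := stalk (peA he').

(** Left multiplication by f, as a map from A to fA. *)
Definition eA_proj (f : A) : 'Hom(regmod A, eA f) :=
  @corestr _ _ (regmod A) (regmod A) _ (@rideal_submodule _ A <[f]>) (amull f).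

Lemma eA_projE f (x : regmod A) : vsval (eA_proj f x) = f * x.
Proof.
rewrite [LHS](@corestrE _ _ (regmod A) (regmod A)) lfunE //=.
by rewrite memv_mul ?memvf ?memv_line.
Qed.

Lemma eA_proj_rhom f : rhom (eA_proj f).
Proof.
apply: corestr_rhom => [a x|x]; first by rewrite !regmodE !lfunE /= mulrA.
by rewrite lfunE /= memv_mul ?memvf ?memv_line.
Qed.

Definition eA_inj (f : A) : 'Hom(eA f, regmod A) :=
  subin (@rideal_submodule _ A <[f]>).

Lemma eA_injE f x : eA_inj f x = vsval x.
Proof. exact: subinE. Qed.

Lemma eA_inj_rhom f : rhom (eA_inj f).
Proof. exact: subin_rhom. Qed.

Lemma eA_projK f (hf : f * f = f) (x : eA f) : eA_proj f (eA_inj f x) = x.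
Proof. by apply: val_inj; rewrite [LHS]eA_projE eA_injE eA_val. Qed.

Lemma eA_proj_inj0 f g (hg : g * g = g) (x : eA g) : f * g = 0 ->
  eA_proj f (eA_inj g x) = 0.
Proof.
move=> fg; apply: val_inj; rewrite [LHS]eA_projE eA_injE -(eA_val hg x) mulrA fg.
by rewrite mul0r.
Qed.

Lemma stalk_regmod : isoT (stalk (pA A)) (csum X M').
Proof.
apply: isoT_trans (stalk_psum (peA he) (peA he')).
pose u : 'Hom(pA A, psum (peA he) (peA he')) := pairl (eA_proj e) (eA_proj (1 - e)).
pose v : 'Hom(psum (peA he) (peA he'), pA A) :=
  copairl (eA_inj e) (eA_inj (1 - e)).
have hu : rhom u.
  by apply: (@rhom_pairl _ _ (regmod A)); apply: eA_proj_rhom.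
have hv : rhom v.
  by apply: (@rhom_copairl _ _ (regmod A)); apply: eA_inj_rhom.
have uE x : u x = (eA_proj e x, eA_proj (1 - e) x) by rewrite /u pairlE.
have vE x : v x = eA_inj e x.1 + eA_inj (1 - e) x.2.
  by rewrite /v copairlE.
have vu x : v (u x) = x.
  rewrite vE uE [(_, _).1]/= [(_, _).2]/= !eA_injE !eA_projE -mulrDl.
  by rewrite [X in X * _]addrC subrK mul1r.
have uv x : u (v x) = x.
  case: x => x y; rewrite vE uE [(_, _).1]/= [(_, _).2]/= !linearD /=.
  rewrite !eA_projK // !eA_proj_inj0 ?mul_ee' ?mul_e'e //.
  by congr pair; rewrite ?addr0 ?add0r.
exact: (conc0_iso (@conc0_stalk _ _ _) (@conc0_stalk _ _ _) hu hv vu uv).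
Qed.

Lemma two_term_conc01 : conc01 N.
Proof. by move=> [[|[|i]]|i] // _ _ x; apply/rowP; case. Qed.

(** The three chain maps of the exchange triangle N -> D -> X -> N[1], where
    N = (P -> eA), D = P and X = eA. *)
Lemma exchange_fst : exists a : chmap N D, a 0 = \1%VF.
Proof.
pose a (i : int) : 'Hom(N i, D i) :=
  match i return 'Hom(N i, D i) with Posz 0 => \1%VF | _ => 0 end.
have [||f fE] := @chmapI _ _ N D a.
- by move=> [[|i]|i]; rewrite /a; (try exact: rhom0); apply: rhom1.
- move=> i x; have [i0|i0] := eqVneq (i + 1) 0; last first.
    by rewrite [LHS](@conc0_stalk _ _ P) // [RHS](@conc0_stalk _ _ P).
  have ei : i = - 1 by lia.
  by subst i; rewrite (@two_term_conc01 _ _ _ x) // !linear0.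
by exists f; apply/lfunP => x; rewrite fE.
Qed.

Lemma exchange_snd : exists g : chmap D X, g 0 = p.
Proof. exact: (@conc0_chmap _ _ D X p (@conc0_stalk _ _ _) (@conc0_stalk _ _ _) hp). Qed.

Lemma exchange_trd : exists b : chmap X (shift N 1), b 0 = \1%VF.
Proof.
pose b (i : int) : 'Hom(X i, shift N 1 i) :=
  match i return 'Hom(X i, shift N 1 i) with Posz 0 => \1%VF | _ => 0 end.
have [||f fE] := @chmapI _ _ X (shift N 1) b.
- by move=> [[|i]|i]; rewrite /b; (try exact: rhom0); apply: rhom1.
- move=> i x; have [i0|i0] := eqVneq i 0; last first.
    by rewrite (@conc0_stalk _ _ _ _ i0 x) !linear0.
  have hz (y : shift N 1 (i + 1)) : y = 0 by apply: two_term_conc01; lia.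
  by rewrite [LHS]hz [RHS]hz.
by exists f; apply/lfunP => x; rewrite fE.
Qed.

Lemma cone_exchange0 (a : chmap N D) i :
  i != 0 -> i != - 1 -> forall x : cone a i, x = 0.
Proof.
move=> i0 i1 [x y].
have -> : x = 0 by apply: two_term_conc01; lia.
have -> : y = 0 by apply: conc0_stalk.
by [].
Qed.

(** The cone of N -> D is eA + P in degree 0 and P in degree -1, with
    differential z |-> (- p z, z); hence it is homotopy equivalent to eA. *)
Lemma exchange_triangle (a : chmap N D) (g : chmap D X) (b : chmap X (shift N 1)) :
  a 0 = \1%VF -> g 0 = p -> b 0 = \1%VF -> distinguished a g b.
Proof.
move=> aE gE bE.
have dC (z : cone a (- 1)) : cd (cone a) (- 1) (- 1 + 1) z = (- p z.1, z.1) :> cone a 0.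
  rewrite cone_dE; apply: injective_projections => //=.
  rewrite [X in _ + X](_ : _ = 0) ?addr0 //; first by rewrite aE id_lfunE.
  exact: lfun0E.
(* The homotopy equivalences are y |-> (y, 0) and (y, z) |-> y + p z. *)
pose c (i : int) : 'Hom(X i, cone a i) :=
  match i return 'Hom(X i, cone a i) with
  | Posz 0 => in1 (eA e) P | _ => 0 end.
have [||c' cE] := @chmapI _ _ X (cone a) c.
- by move=> [[|i]|i]; rewrite /c; (try exact: rhom0); apply: rhom_in1.
- move=> i x; have [i0|i0] := eqVneq i 0; last first.
    by rewrite (@conc0_stalk _ _ _ _ i0 x) !linear0.
  have hz (y : cone a (i + 1)) : y = 0 by apply: cone_exchange0; lia.
  by rewrite [LHS]hz [RHS]hz.
pose d (i : int) : 'Hom(cone a i, X i) :=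
  match i return 'Hom(cone a i, X i) with
  | Posz 0 => copairl \1%VF p | _ => 0 end.
have [||d' dE] := @chmapI _ _ (cone a) X d.
- move=> [[|i]|i]; rewrite /d; (try exact: rhom0).
  by apply: (@rhom_copairl _ _ (eA e) (eA e) P) => //; apply: rhom1.
- move=> i x; have [i0|i0] := eqVneq (i + 1) 0; last first.
    by rewrite [LHS](@conc0_stalk _ _ (peA he)) // [RHS](@conc0_stalk _ _ (peA he)).
  have ei : i = - 1 by lia.
  subst i; have -> : d (- 1) x = 0 by exact: lfun0E.
  rewrite linear0 dC.
  have -> : d (- 1 + 1) (- p x.1, x.1) = - p x.1 + p x.1.
    by rewrite /d copairlE id_lfunE.
  exact: addNr.
(* The homotopies used below are nonzero only from degree 0 to degree -1. *)
pose H (Z : cpx A) (F : 'Hom(Z 0, cone a (- 1))) (i j : int) : 'Hom(Z i, cone a j) :=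
  match i, j return 'Hom(Z i, cone a j) with
  | Posz 0, Negz 0 => F | _, _ => 0 end.
have Hr Z F : rhom F -> forall i j, rhom (@H Z F i j).
  move=> hF [[|i]|i] [j|[|j]]; rewrite /H; (try exact: rhom0); exact: hF.
have ci : chiso c'.
  exists d'; split.
    apply: homotopic_eq => i x; rewrite comp_lfunE cE dE id_lfunE.
    have [i0|i0] := eqVneq i 0; last first.
      by rewrite (@conc0_stalk _ _ _ _ i0 x) !linear0.
    subst i; rewrite /d /c in1E copairlE id_lfunE linear0.
    exact: addr0.
  apply: homotopic_sym.
  pose F : 'Hom(cone a 0, cone a (- 1)) :=
    pairl (pr2 (eA e) P) (0 : 'Hom((eA e * P)%type, pzero A)).
  have hF : rhom F.
    apply: (@rhom_pairl _ _ (rsum (eA e) P) P (pzero A)); first exact: rhom_pr2.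
    exact: rhom0.
  apply: (@homotopicI _ _ _ _ _ _ (H _ F)); first exact: Hr.
  move=> i x; rewrite comp_lfunE dE cE id_lfunE.
  have [i0|i0] := eqVneq (i + 1) 0.
    have ei : i = - 1 by lia.
    subst i; have -> : H _ F (- 1 + 1) (- 1) x = F x by [].
    have -> : H _ F (- 1 + 1 + 1) (- 1 + 1) (cd (cone a) (- 1 + 1) (- 1 + 1 + 1) x) = 0.
      exact: lfun0E.
    rewrite addr0 dC {hF}/F pairlE; case: x => y u.
    rewrite /c /d copairlE id_lfunE in1E pr2E [(_, _).1]/= [(_, _).2]/=.
    by apply: injective_projections; rewrite /= ?subr0 // opprD addNKr.
  have [i1|i1] := eqVneq (i + 1) (- 1).
    have ei : i = - 2 by lia.
    subst i; have hz (y : cone a (- 2)) : y = 0 by apply: cone_exchange0.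
    rewrite [X in cd _ _ _ X]hz linear0 add0r.
    have -> : d (- 2 + 1) x = 0 by exact: lfun0E.
    have -> : H _ F (- 2 + 1 + 1) (- 2 + 1)
        (cd (cone a) (- 2 + 1) (- 2 + 1 + 1) x) = F (cd (cone a) (- 1) (- 1 + 1) x).
      by [].
    rewrite dC linear0 subr0 {hF}/F pairlE pr2E lfun0E.
    case: x => x y; apply: injective_projections => //=.
    by apply/rowP; case.
  by rewrite (cone_exchange0 i0 i1 x) !linear0 ?subr0 ?addr0.
exists N, D, a, (chid N), (chid D), c'; split.
- by split; [apply: chiso_id|apply: chiso_id|].
- by apply: homotopic_eq => i x; rewrite !comp_lfunE !id_lfunE.
- pose F : 'Hom(D 0, cone a (- 1)) :=
    pairl (- \1%VF : 'Hom(P, P)) (0 : 'Hom(P, pzero A)).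
  have hF : rhom F.
    apply: (@rhom_pairl _ _ P P (pzero A)); last exact: rhom0.
    by apply: rhomN; apply: rhom1.
  apply: (@homotopicI _ _ _ _ _ _ (H D F)); first exact: Hr.
  move=> i x; have [i0|i0] := eqVneq (i + 1) 0; last first.
    by rewrite (@conc0_stalk _ _ _ _ i0 x) !linear0 ?subr0 ?addr0.
  have ei : i = - 1 by lia.
  subst i; have -> : H D F (- 1 + 1) (- 1) x = F x by [].
  have -> : cd D (- 1 + 1) (- 1 + 1 + 1) x = 0 by apply: conc0_stalk.
  rewrite linear0 addr0 dC [chcomp c' g _ _]comp_lfunE cE.
  rewrite [chcomp _ (chid D) _ _]comp_lfunE id_lfunE.
  have -> : g (- 1 + 1) x = p x by rewrite -gE.
  rewrite {hF}/F pairlE opp_lfunE id_lfunE -[(_, _).1]/(- x) (linearN p) opprK.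
  rewrite /c in1E [X in _ - X]in2E.
  by apply: injective_projections; rewrite /= ?subr0 ?sub0r.
apply: homotopic_eq => i x; have [i0|i0] := eqVneq i 0; last first.
  by rewrite (@conc0_stalk _ _ _ _ i0 x) !linear0.
subst i; rewrite !comp_lfunE cE bE /c in1E.
by rewrite [RHS]pr1E [LHS]id_lfunE id_lfunE.
Qed.

End OkuyamaRickard.

Section OkuyamaRickard.
Variables (k : fieldType) (A : falgType k).
Variables (e : A) (he : e * e = e) (P : projcover (eAe'A e)).
Let he' := idem_compl he.
Let p := p_e he P.
Let hp : rhom p := @p_e_rhom _ _ _ he P.
Let N := two_term hp.
Let D := stalk P.
Let X := stalk (peA he).
Let M' := stalk (peA he').

(** Every map from add (1-e)A to eA in the homotopy category factors through
    the map P -> eA. *)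
Lemma exchange_approx (g : chmap D X) D' : g 0 = p -> add_closure M' D' ->
  forall u : chmap D' X, exists v : chmap D' D, homotopic (chcomp g v) u.
Proof.
move=> gE; elim=> {D'} [|| X1 X2 _ h1 _ h2 | X1 X2 _ h12 | X1 X2 [f [f' [_ ff']]] _ h1] u.
- have [h hh hE] := @madd_lift _ _ e he P (peA he') (u 0) (madd_self _) (@cm_rhom _ _ _ _ u 0).
  have [v vE] := @conc0_chmap _ _ M' D h (@conc0_stalk _ _ _) (@conc0_stalk _ _ _) hh.
  exists v; apply: homotopic_eq => i x; have [i0|i0] := eqVneq i 0; last first.
    by rewrite (@conc0_stalk _ _ _ _ i0 x) !linear0.
  by subst i; rewrite comp_lfunE vE gE; apply: hE.
- exists (chzero _ _); apply: homotopic_eq => i x.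
  by have -> : x = 0; [apply/rowP; case|rewrite !linear0].
- have [j1 j1E] := chmap_in1 X1 X2; have [j2 j2E] := chmap_in2 X1 X2.
  have [v1 /homotopicE[t1 tr1 th1]] := h1 (chcomp u j1).
  have [v2 /homotopicE[t2 tr2 th2]] := h2 (chcomp u j2).
  have [||v vE] := @chmapI _ _ (csum X1 X2) D (fun i => copairl (v1 i) (v2 i)).
  - by move=> i; rhom_auto.
  - by move=> i x; rewrite csum_dE !copairlE [(_, _).1]/= [(_, _).2]/= !cm_commE [RHS]linearD.
  exists v; apply: (@homotopicI _ _ (csum X1 X2) X _ _ (fun i j => copairl (t1 i j) (t2 i j))).
    by move=> i j; rhom_auto.
  move=> i [x y]; rewrite csum_dE !copairlE [(_, _).1]/= [(_, _).2]/= [X in _ = X + _]linearD.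
  rewrite addrACA -th1 -th2 !comp_lfunE vE copairlE linearD /= j1E j2E.
  have -> : (x, y) = (x, 0) + (0, y) :> csum X1 X2 (i + 1).
    by apply: injective_projections; rewrite /= ?addr0 ?add0r.
  by rewrite [X in _ - X]linearD /= opprD addrACA.
- have [j1 j1E] := chmap_in1 X1 X2; have [q qE] := chmap_pr1 X1 X2.
  have [v vu] := h12 (chcomp u q); exists (chcomp v j1).
  apply: homotopic_trans (chcompA _ _ _) _.
  apply: homotopic_trans (homotopic_compr _ vu) _.
  by apply: homotopic_eq => i x; rewrite !comp_lfunE j1E qE.
have [v vu] := h1 (chcomp u f); exists (chcomp v f').
apply: homotopic_trans (chcompA _ _ _) _.
apply: homotopic_trans (homotopic_compr _ vu) _.
apply: homotopic_trans (homotopic_sym (chcompA _ _ _)) _.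
by apply: homotopic_trans (chcomp1r u); apply: homotopic_compl.
Qed.

(** The approximation P -> eA is minimal because P is a projective cover. *)
Lemma exchange_minimal (g : chmap D X) : g 0 = p -> right_minimal g.
Proof.
move=> gE h [t [_ th]]; have ph x : p (h 0 x) = p x.
  have /lfunP/(_ x) := th (- 1) 0 1 erefl erefl.
  rewrite add_lfunE opp_lfunE comp_lfunE gE => /eqP.
  rewrite add_lfunE !comp_lfunE [cd X _ _ _]lfun0E [cd D _ _ _]lfun0E.
  by rewrite linear0 addr0 subr_eq0 => /eqP.
have pch x : pc_map P (h 0 x) = pc_map P x.
  apply: val_inj; apply: etrans (esym (p_eE he (h 0 x))) _.
  exact: etrans (congr1 val (ph x)) (p_eE he x).
have sh : limg (h 0) = fullv.
  apply: (@pc_superfluous _ _ _ P); first exact/limg_submodule/(@cm_rhom _ _ _ _ h 0).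
  apply/eqP; rewrite eqEsubv subvf; apply/subvP => x _.
  rewrite -(subrK (h 0 x) x) addrC memv_add ?memv_img ?memvf //.
  by rewrite memv_ker linearB /= pch subrr.
have [l [hl lh hl']] := rhom_inv (@cm_rhom _ _ _ _ h 0) (lker0_of_surj sh) sh.
have [l' l'E] := @conc0_chmap _ _ D D l (@conc0_stalk _ _ _) (@conc0_stalk _ _ _) hl.
by exists l'; split; apply: homotopic_eq => i x; (have [i0|i0] := eqVneq i 0;
  [subst i; rewrite comp_lfunE id_lfunE l'E; auto
  |rewrite (@conc0_stalk _ _ _ _ i0 x) !linear0]).
Qed.

Let T := okuyama_rickard he P.

Lemma okuyama_rickard_mutation : right_mutation (stalk (pA A)) X M' T.
Proof.
have [a aE] := exchange_fst he P; have [g gE] := exchange_snd he P.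
have [b bE] := exchange_trd he P.
split; first exact: (stalk_regmod he).
exists N, D, a, g, b; split.
- split; first by apply: stalk_madd; apply: projcover_madd.
  by move=> D' u aD'; apply: exchange_approx.
- exact: exchange_minimal.
- exact: exchange_triangle.
- exact: isoT_refl.
Qed.

Lemma okuyama_rickard_conc01 : conc01 T.
Proof.
move=> i i0 i1 [x y]; rewrite (two_term_conc01 i0 i1 x).
by rewrite (@conc0_stalk _ _ _ i i0 y).
Qed.

Lemma okuyama_rickard_dE (x : T 0) : cd T 0 1 x = (p x.1, 0) :> T 1.
Proof. by rewrite csum_dE; congr pair; apply: lfun0E. Qed.

Lemma okuyama_rickard_generates : generates T.
Proof.
move=> S hS sT; apply: thick_all => //.
have sN : S N := thick_summand hS sT.
have sM : S M' := thick_summand hS (thick_iso hS (isoT_csumC N M') sT).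
have sD : S D by apply: (thick_add hS sM); apply: stalk_madd; apply: projcover_madd.
have [a aE] := exchange_fst he P; have [g gE] := exchange_snd he P.
have [b bE] := exchange_trd he P.
have sX : S X := thick_cone hS (exchange_triangle aE gE bE) sN sD.
by apply: (thick_iso hS (isoT_sym (stalk_regmod he))); apply: thick_csum.
Qed.

Lemma okuyama_rickard_silting : silting T.
Proof.
split; last exact: okuyama_rickard_generates.
move=> i i_gt0; have [->|i1] := eqVneq i 1; last first.
  by apply: (hom_zero_conc01 okuyama_rickard_conc01); lia.
have lift (f : 'Hom(psum P (peA he'), psum (peA he) (pzero A))) : rhom f ->
    exists2 h : 'Hom(psum P (peA he'), psum P (peA he')), rhom h &
    forall x, (p (h x).1, 0) = f x.
  move=> hf; pose f1 := (pr1 (eA e) (rzero A) \o f)%VF.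
  have hf1 : rhom f1 by apply: rhom_comp hf; apply: rhom_pr1.
  have mR : madd (peA he') (psum P (peA he')).
    by apply: madd_sum; [apply: projcover_madd|apply: madd_self].
  have [h hh hE] := @madd_lift _ _ e he P _ f1 mR hf1.
  exists (pairl h 0); first by apply: rhom_pairl => //; apply: rhom0.
  move=> x; rewrite pairlE [(_, _).1]/= [p _]hE /f1 comp_lfunE pr1E.
  by apply: injective_projections => //; apply/rowP; case.
apply: (hom_zero_shift1 okuyama_rickard_conc01) => f hf.
have [h hh hE] := lift f hf; exists h => // x.
by rewrite okuyama_rickard_dE; apply: hE.
Qed.

(** The only obstruction to being tilting is Hom(T, T[-1]), which consists of
    maps from eA to P + (1-e)A that vanish on eA(1-e)A. *)
Lemma okuyama_rickard_tilting : tilting T <->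
  (forall f : 'Hom(eA_mod_eAe'A e, eA (1 - e)), rhom f -> f = 0).
Proof.
have cT := okuyama_rickard_conc01.
split=> [[hz _] f hf|h0].
  pose hU := @eAe'A_in_eA_submodule _ _ e.
  pose F : 'Hom(psum (peA he) (pzero A), psum P (peA he')) :=
    pairl (0 : 'Hom(psum (peA he) (pzero A), P)) (f \o quotpi hU \o pr1 _ _)%VF.
  have FE x : F x = (0, f (quotpi hU x.1)).
    by rewrite /F pairlE lfun0E [X in (_, X)]comp_lfunE [X in (_, X)]comp_lfunE pr1E.
  have F0 : F = 0.
    have /(hom_zero_shiftN1 cT) := hz (- 1) isT; apply.
    - apply: rhom_pairl; first exact: rhom0.
      apply: rhom_comp (@rhom_pr1 _ _ _ _); apply: rhom_comp => //.
      exact: quotpi_rhom.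
    - move=> x; rewrite okuyama_rickard_dE [LHS]FE [(_, _).1]/=.
      have /eqP -> : quotpi hU (p x.1) == 0.
        by rewrite -memv_ker quotpi_ker p_e_trace.
      by rewrite linear0.
    - move=> x; rewrite [F x]FE okuyama_rickard_dE [(_, _).1]/=.
      by rewrite (linear0 p).
  apply/lfunP => y; have /limg_fullP/(_ y)[x <-] := quotpi_surj hU.
  have /lfunP/(_ (x, 0)) := F0; rewrite FE !lfun0E => E.
  exact: (congr1 snd E).
split; last exact: okuyama_rickard_generates.
move=> i i0; have [i_gt0|i_le0] := boolP (0 < i)%R.
  exact: (proj1 okuyama_rickard_silting).
have [->|i1] := eqVneq i (- 1); last by apply: (hom_zero_conc01 cT); lia.
apply/(hom_zero_shiftN1 cT) => f hf fd df.
have f0 : (f \o in1 (eA e) (rzero A))%VF = 0.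
  apply: (madd_kill (R := psum P (peA he')) h0).
  - by apply: madd_sum; [apply: projcover_madd|apply: madd_self].
  - by apply: rhom_comp => //; apply: rhom_in1.
  move=> x /(p_e_onto he P)[y <-]; rewrite comp_lfunE in1E.
  by have := fd (y, 0); rewrite okuyama_rickard_dE.
apply/lfunP => -[x y]; have -> : y = 0 by apply/rowP; case.
by have /lfunP/(_ x) := f0; rewrite comp_lfunE in1E !lfun0E.
Qed.

End OkuyamaRickard.

(** * Fitting's lemma and the uniqueness of decompositions *)

(** An object with a given property and of minimal size exists. *)
Lemma ex_minimal (T : Type) (Q : T -> Prop) (u : T -> nat) :
  (exists x, Q x) -> exists2 x, Q x & forall y, Q y -> (u x <= u y)%N.
Proof.
move=> [x Qx]; have [n] := ubnP (u x); elim: n x Qx => // n IH x Qx ux.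
have [[y [Qy yx]]|h] := classic (exists y, Q y /\ (u y < u x)%N).
  by apply: (IH y) => //; apply: leq_trans yx _.
exists x => // y Qy; rewrite leqNgt; apply/negP => yx; apply: h; by exists y.
Qed.

Section Fitting.
Variables (k : fieldType) (A : falgType k).
Implicit Types (M N X Y S : rmod A).

(** Injectivity of a homomorphism. *)
Definition linj M N (f : 'Hom(M, N)) : Prop := forall x, f x = 0 -> x = 0.

Lemma linj_lker M N (f : 'Hom(M, N)) : linj f <-> lker f = 0%VS.
Proof.
split=> [h|h x /eqP].
  by apply/eqP; rewrite -subv0; apply/subvP => x; rewrite memv_ker memv0 => /eqP/h ->.
by rewrite -memv_ker h memv0 => /eqP.
Qed.

Lemma linj_endo M (f : 'Hom(M, M)) : rhom f -> linj f ->
  exists w : 'Hom(M, M), [/\ rhom w, forall x, w (f x) = x & forall x, f (w x) = x].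
Proof.
move=> hf /linj_lker kf; apply: rhom_inv => //.
by apply/eqP; rewrite eqEdim subvf /= -(limg_ker_dim f fullv) kf capv0 dimv0.
Qed.

(** The n-th power of an endomorphism. *)
Definition lpow M (f : 'Hom(M, M)) n : 'Hom(M, M) :=
  iter n (fun g => (f \o g)%VF) \1%VF.

Lemma lpow0 M (f : 'Hom(M, M)) x : lpow f 0 x = x.
Proof. by rewrite /lpow /= id_lfunE. Qed.

Lemma lpowS M (f : 'Hom(M, M)) n x : lpow f n.+1 x = f (lpow f n x).
Proof. by rewrite /lpow /= comp_lfunE. Qed.

Lemma lpowD M (f : 'Hom(M, M)) m n x : lpow f (m + n) x = lpow f m (lpow f n x).
Proof. by elim: m => [|m IH]; rewrite ?lpow0 // addSn !lpowS IH. Qed.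

Lemma lpowSr M (f : 'Hom(M, M)) n x : lpow f n.+1 x = lpow f n (f x).
Proof. by rewrite -addn1 lpowD lpowS lpow0. Qed.

Lemma lpow_rhom M (f : 'Hom(M, M)) n : rhom f -> rhom (lpow f n).
Proof.
move=> hf; elim: n => [|n IH]; first by move=> a x; rewrite !lpow0.
by move=> a x; rewrite !lpowS IH hf.
Qed.

Lemma lpow_fix M (f : 'Hom(M, M)) n x : f x = x -> lpow f n x = x.
Proof. by move=> fx; elim: n => [|n IH]; rewrite ?lpow0 // lpowS IH. Qed.

(** Fitting: some positive power of f has an image meeting its kernel in 0. *)
Lemma fitting M (f : 'Hom(M, M)) : exists n,
  forall x, x \in limg (lpow f n.+1) -> lpow f n.+1 x = 0 -> x = 0.
Proof.
have [|n _ hn] :=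
  @ex_minimal nat (fun _ => True) (fun n => \dim (limg (lpow f n.+1))).
  by exists 0%N.
(* The powers g and g o g have images of the same dimension by the choice of n,
   so g is injective on its image. *)
exists n; set g := lpow f n.+1 => x xg gx.
have gg : limg (lpow f (n + n.+1).+1) = (g @: limg g)%VS.
  have -> : lpow f (n + n.+1).+1 = (g \o g)%VF.
    by apply/lfunP => y; rewrite comp_lfunE -addSn lpowD.
  exact: limg_comp.
have := hn (n + n.+1)%N I; rewrite gg -/g -(limg_ker_dim g (limg g)).
rewrite -[X in (_ <= X)%N]add0n leq_add2r leqn0 dimv_eq0 => /eqP k0.
by apply/eqP; rewrite -memv0 -k0 memv_cap xg memv_ker gx eqxx.
Qed.

Lemma cap0_sum M (f : 'Hom(M, M)) : (limg f :&: lker f)%VS = 0%VS ->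
  (limg f + lker f)%VS = fullv.
Proof.
move=> c0; apply/eqP; rewrite eqEdim subvf /= dimv_disjoint_sum // addnC.
by rewrite -(limg_ker_dim f fullv) capfv.
Qed.

Lemma indec_fitting M (f : 'Hom(M, M)) : indecomposable M -> rhom f ->
  linj f \/ exists n, forall x, lpow f n x = 0.
Proof.
move=> [_ hM] hf; have [n hn] := fitting f.
have hp := lpow_rhom n.+1 hf.
have c0 : (limg (lpow f n.+1) :&: lker (lpow f n.+1))%VS = 0%VS.
  apply/eqP; rewrite -subv0; apply/subvP => x.
  by rewrite memv_cap memv_ker memv0 => /andP[xg /eqP /hn ->].
have [g0|k0] := hM _ _ (limg_submodule hp) (lker_submodule hp) (cap0_sum c0) c0.
  right; exists n.+1 => x; apply/eqP; rewrite -memv0 -g0.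
  by rewrite memv_img ?memvf.
left=> x fx; apply/eqP; rewrite -memv0 -k0 memv_ker lpowSr fx.
by rewrite linear0.
Qed.

(** The endomorphism ring of an indecomposable module is local. *)
Lemma indec_local M (f g : 'Hom(M, M)) : indecomposable M -> rhom f -> rhom g ->
  linj (f + g) -> linj f \/ linj g.
Proof.
move=> iM hf hg fg; have [w [hw wu _]] := linj_endo (rhomD hf hg) fg.
have [hi|[n hn]] := indec_fitting iM (rhom_comp hw hf).
  by left=> x fx; apply: hi; rewrite comp_lfunE fx linear0.
right=> x gx; rewrite -(hn x); symmetry; apply: lpow_fix.
by rewrite comp_lfunE -{2}(wu x) add_lfunE gx addr0.
Qed.

(** If f is injective and u = f + g is not, then g is injective. *)
Lemma indec_localB M (f g u : 'Hom(M, M)) : indecomposable M -> rhom u -> rhom g ->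
  (forall x, u x = f x + g x) -> linj f -> ~ linj u -> linj g.
Proof.
move=> iM hu hg E fi ui.
have [|//|h] := indec_local iM hu (rhomN hg).
  by move=> x; rewrite add_lfunE opp_lfunE E addrK; apply: fi.
by move=> x gx; apply: h; rewrite opp_lfunE gx oppr0.
Qed.

Lemma riso_sym M N : riso M N -> riso N M.
Proof. by move=> [f [g [hf hg gf fg]]]; exists g, f. Qed.

Lemma riso_trans M N X : riso M N -> riso N X -> riso M X.
Proof.
move=> [f [g [hf hg gf fg]]] [f' [g' [hf' hg' gf' fg']]].
exists (f' \o f)%VF, (g \o g')%VF; split; try exact: rhom_comp.
  by rewrite comp_lfunA -(comp_lfunA g) gf' comp_lfun1r.
by rewrite comp_lfunA -(comp_lfunA f') fg comp_lfun1r.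
Qed.

(** A nonzero summand of an indecomposable module is the whole module. *)
Lemma indec_summand X S (i : 'Hom(X, S)) (p : 'Hom(S, X)) :
  indecomposable X -> indecomposable S -> rhom i -> rhom p -> linj (p \o i)%VF ->
  [/\ riso X S, linj i, linj p & limg i = fullv].
Proof.
move=> [[x0 x0n] _] [_ hS] hi hp pi.
have [w [hw wp pw]] := linj_endo (rhom_comp hp hi) pi.
have ii : linj i by move=> x ix; apply: pi; rewrite comp_lfunE ix linear0.
have c0 : (limg i :&: lker p)%VS = 0%VS.
  apply/eqP; rewrite -subv0; apply/subvP => s.
  rewrite memv_cap memv_ker memv0 => /andP[/memv_imgP[x _ ->] /eqP px].
  by rewrite (pi x) ?linear0 // comp_lfunE.
have s1 : (limg i + lker p)%VS = fullv.
  apply/eqP; rewrite eqEsubv subvf; apply/subvP => s _.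
  rewrite -(subrK (i (w (p s))) s) addrC memv_add ?memv_img ?memvf //.
  by rewrite memv_ker linearB /= -[p (i _)]comp_lfunE pw subrr.
have [l0|k0] := hS _ _ (limg_submodule hi) (lker_submodule hp) s1 c0.
  case: x0n; apply: ii; apply/eqP; rewrite -memv0 -l0; exact: memv_img (memvf _).
have si : limg i = fullv by rewrite -s1 k0 addv0.
have [g [hg gi ig]] := rhom_inv hi (proj1 (linj_lker i) ii) si.
split=> //; last exact/linj_lker.
exists i, g; split=> //; apply/lfunP => x; by rewrite comp_lfunE ?gi ?ig id_lfunE.
Qed.

(** Maps into and out of a direct sum in components. *)
Lemma rsum_maps_in X M N (i : 'Hom(X, rsum M N)) : rhom i ->
  exists i1 : 'Hom(X, M), exists i2 : 'Hom(X, N),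
  [/\ rhom i1, rhom i2 & forall x, i x = (i1 x, i2 x)].
Proof.
move=> hi; exists (pr1 M N \o i)%VF, (pr2 M N \o i)%VF; split.
- by apply: rhom_comp hi; apply: rhom_pr1.
- by apply: rhom_comp hi; apply: rhom_pr2.
by move=> x; rewrite !comp_lfunE !biprodE; case: (i x).
Qed.

Lemma rsum_maps_out X M N (p : 'Hom(rsum M N, X)) : rhom p ->
  exists p1 : 'Hom(M, X), exists p2 : 'Hom(N, X),
  [/\ rhom p1, rhom p2 & forall y, p y = p1 y.1 + p2 y.2].
Proof.
move=> hp; exists (p \o in1 M N)%VF, (p \o in2 M N)%VF; split.
- by apply: rhom_comp hp _; apply: rhom_in1.
- by apply: rhom_comp hp _; apply: rhom_in2.
move=> y; rewrite !comp_lfunE !biprodE -linearD /=; congr (p _).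
by apply: injective_projections; rewrite /= ?addr0 ?add0r.
Qed.

Lemma rsum_comp X Y M N (i : 'Hom(X, rsum M N)) (i1 : 'Hom(X, M)) (i2 : 'Hom(X, N))
    (p : 'Hom(rsum M N, Y)) (p1 : 'Hom(M, Y)) (p2 : 'Hom(N, Y)) :
  (forall x, i x = (i1 x, i2 x)) -> (forall y, p y = p1 y.1 + p2 y.2) ->
  forall x, p (i x) = p1 (i1 x) + p2 (i2 x).
Proof. by move=> iE pE x; rewrite pE iE. Qed.

(** An indecomposable summand of a direct sum of indecomposables is isomorphic
    to one of them. *)
Lemma indec_in_sum X (s : seq (rmod A)) (i : 'Hom(X, foldr (@rsum k A) (rzero A) s))
    (p : 'Hom(foldr (@rsum k A) (rzero A) s, X)) :
  indecomposable X ->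
  (forall j, (j < size s)%N -> indecomposable (nth (rzero A) s j)) ->
  rhom i -> rhom p -> linj (p \o i)%VF ->
  exists2 j, (j < size s)%N & riso X (nth (rzero A) s j).
Proof.
move=> iX; elim: s i p => [|S s IH] /= i p hs hi hp pi.
  have [[x x0] _] := iX; case: x0; apply: pi; rewrite comp_lfunE.
  by have -> : i x = 0; [apply/rowP; case|rewrite linear0].
move: (foldr _ _ s) IH i p hi hp pi => F IH i p hi hp pi.
have [i1 [i2 [hi1 hi2 iE]]] := rsum_maps_in hi.
have [p1 [p2 [hp1 hp2 pE]]] := rsum_maps_out hp.
have [|||h|h] := @indec_local _ (p1 \o i1)%VF (p2 \o i2)%VF iX.
- exact: rhom_comp.
- exact: rhom_comp.
- by move=> x; rewrite add_lfunE !comp_lfunE -(rsum_comp iE pE) -comp_lfunE; apply: pi.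
- have [h1 _ _ _] := indec_summand iX (hs 0%N isT) hi1 hp1 h.
  by exists 0%N.
have [|j js ij] := IH i2 p2 _ hi2 hp2 h; first by move=> j js; apply: (hs j.+1).
by exists j.+1.
Qed.

(** In a direct sum of pairwise non-isomorphic indecomposables, an indecomposable
    module is not a summand twice. *)
Lemma indec_not_twice X (s : seq (rmod A))
    (i i' : 'Hom(X, foldr (@rsum k A) (rzero A) s))
    (p p' : 'Hom(foldr (@rsum k A) (rzero A) s, X)) :
  indecomposable X ->
  (forall j, (j < size s)%N -> indecomposable (nth (rzero A) s j)) ->
  (forall j l, (j < size s)%N -> (l < size s)%N -> j <> l ->
     ~ riso (nth (rzero A) s j) (nth (rzero A) s l)) ->
  rhom i -> rhom i' -> rhom p -> rhom p' ->
  linj (p \o i)%VF -> linj (p' \o i')%VF -> linj (p \o i')%VF.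
Proof.
move=> iX; elim: s i i' p p' => [|S s IH] /= i i' p p' hs hd hi hi' hp hp' pi pi'.
  have [[x x0] _] := iX; case: x0; apply: pi; rewrite comp_lfunE.
  by have -> : i x = 0; [apply/rowP; case|rewrite linear0].
have nS (u : 'Hom(X, foldr (@rsum k A) (rzero A) s))
    (v : 'Hom(foldr (@rsum k A) (rzero A) s, X)) :
    rhom u -> rhom v -> linj (v \o u)%VF -> ~ riso X S.
  move=> hu hv vu XS.
  have [|j js Xj] := indec_in_sum iX _ hu hv vu.
    by move=> j js; apply: (hs j.+1).
  by apply: (hd 0%N j.+1) => //; apply: riso_trans (riso_sym XS) Xj.
have {hd} hd j l : (j < size s)%N -> (l < size s)%N -> j <> l ->
    ~ riso (nth (rzero A) s j) (nth (rzero A) s l).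
  by move=> js ls jl; apply: (hd j.+1 l.+1) => // -[].
have {}IH := fun i i' p p' => IH i i' p p' (fun j => hs j.+1) hd.
have hS := hs 0%N isT; rewrite /= in hS.
move: (foldr _ _ s) IH nS i i' p p' hi hi' hp hp' pi pi'
  => F IH nS i i' p p' hi hi' hp hp' pi pi' {hs hd s}.
have [i1 [i2 [hi1 hi2 iE]]] := rsum_maps_in hi.
have [i1' [i2' [hi1' hi2' iE']]] := rsum_maps_in hi'.
have [p1 [p2 [hp1 hp2 pE]]] := rsum_maps_out hp.
have [p1' [p2' [hp1' hp2' pE']]] := rsum_maps_out hp'.
have split (u1 : 'Hom(X, S)) (u2 : 'Hom(X, F)) (v1 : 'Hom(S, X)) (v2 : 'Hom(F, X))
    (u : 'Hom(X, rsum S F)) (v : 'Hom(rsum S F, X)) :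
    rhom u1 -> rhom u2 -> rhom v1 -> rhom v2 ->
    (forall x, u x = (u1 x, u2 x)) -> (forall y, v y = v1 y.1 + v2 y.2) ->
    linj (v \o u)%VF -> linj (v1 \o u1)%VF \/ linj (v2 \o u2)%VF.
  move=> hu1 hu2 hv1 hv2 uE vE h.
  apply: (indec_local iX (rhom_comp hv1 hu1) (rhom_comp hv2 hu2)) => x.
  by rewrite add_lfunE !comp_lfunE -(rsum_comp uE vE) -comp_lfunE; apply: h.
(* If S accounts for a copy of X, then X is isomorphic to S, hence to no summand
   of the rest; otherwise both copies of X lie in the rest up to isomorphism. *)
apply: NNPP => npi.
have npiE x : (p \o i')%VF x = (p1 \o i1')%VF x + (p2 \o i2')%VF x.
  by rewrite !comp_lfunE; apply: rsum_comp.
have hpi' := rhom_comp hp hi'.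
have [h1|h2] := split _ _ _ _ _ _ hi1 hi2 hp1 hp2 iE pE pi.
  have [XS _ p1i _] := indec_summand iX hS hi1 hp1 h1.
  have [h1'|h2'] := split _ _ _ _ _ _ hi1' hi2' hp1' hp2' iE' pE' pi'.
    have [_ i1i _ _] := indec_summand iX hS hi1' hp1' h1'.
    apply: (nS i2' p2 hi2' hp2 _ XS).
    apply: (indec_localB iX hpi' (rhom_comp hp2 hi2') npiE) => // x.
    by rewrite comp_lfunE => /p1i/i1i.
  exact: (nS i2' p2' hi2' hp2' h2' XS).
have XnS := nS i2 p2 hi2 hp2 h2.
have [h1'|h2'] := split _ _ _ _ _ _ hi1' hi2' hp1' hp2' iE' pE' pi'.
  by have [XS _ _ _] := indec_summand iX hS hi1' hp1' h1'.
have h22 := IH i2 i2' p2 p2' hi2 hi2' hp2 hp2' h2 h2'.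
have h11 : linj (p1 \o i1')%VF.
  apply: (indec_localB iX hpi' (rhom_comp hp1 hi1') _ h22 npi) => x.
  by rewrite npiE addrC.
by have [XS _ _ _] := indec_summand iX hS hi1' hp1 h11.
Qed.

End Fitting.

(** * Self-injective algebras *)

Section SelfInjective.
Variables (k : fieldType) (A : falgType k).
Implicit Types (M N X Y S : rmod A).

Lemma rhom_daddv M (U V : {vspace M}) : submodule U -> submodule V ->
  (U + V)%VS = fullv -> (U :&: V)%VS = 0%VS -> rhom (daddv_pi U V : 'Hom(M, M)).
Proof.
move=> hU hV sUV cUV.
have dV x : x - daddv_pi U V x \in V.
  have E : daddv_pi U V x + daddv_pi V U x = x.
    by apply: daddv_pi_add; rewrite // sUV memvf.
  by rewrite -{1}E [X in X - _]addrC addrK memv_pi.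
move=> a x; apply/eqP; rewrite -subr_eq0 -memv0 -cUV memv_cap; apply/andP; split.
  by rewrite memvB ?memv_pi // hU ?memv_pi.
have -> : daddv_pi U V (ract M a x) - ract M a (daddv_pi U V x) =
    ract M a (x - daddv_pi U V x) - (ract M a x - daddv_pi U V (ract M a x)).
  by rewrite linearB /= opprB [RHS]addrC addrA subrK.
by rewrite memvB // hV.
Qed.

(** A nonzero module has an indecomposable summand: take one of minimal
    dimension. *)
Lemma exists_indec_summand Y : (exists y : Y, y <> 0) ->
  exists2 X, indecomposable X & exists i : 'Hom(X, Y), exists p : 'Hom(Y, X),
    [/\ rhom i, rhom p & forall x, p (i x) = x].
Proof.
move=> Y0; pose Q X := (exists x : X, x <> 0) /\
  exists i : 'Hom(X, Y), exists p : 'Hom(Y, X),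
    [/\ rhom i, rhom p & forall x, p (i x) = x].
have [|X [X0 XY] Xmin] := @ex_minimal (rmod A) Q (fun X => \dim {:X}).
  exists Y; split=> //; exists \1%VF, \1%VF; split; try exact: rhom1.
  by move=> x; rewrite !id_lfunE.
exists X => //; split=> // U V hU hV sUV cUV.
have [->|U0] := eqVneq U 0%VS; [by left|right].
have [i [p [hi hp pi]]] := XY.
pose t := corestr hU (daddv_pi U V : 'Hom(X, X)).
have ht : rhom t.
  by apply: corestr_rhom => [|x]; [apply: rhom_daddv|apply: memv_pi].
have tE (x : submod hU) : t (subin hU x) = x.
  apply: val_inj; rewrite [LHS]corestrE ?memv_pi // subinE.
  by rewrite daddv_pi_id // subvsP.
have := Xmin (submod hU); rewrite !dimvf => UX.
have {}UX : (\dim {:X} <= \dim U)%N.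
  rewrite dimvf; apply: leq_trans (UX _) _; last exact: leqnn.
  split.
    exists (vsproj U (vpick U)) => /(congr1 val) /=.
    by rewrite vsprojK ?memv_pick // => /eqP; rewrite vpick0 (negPf U0).
  exists (i \o subin hU)%VF, (t \o p)%VF; split.
  - by apply: rhom_comp => //; apply: subin_rhom.
  - exact: rhom_comp.
  by move=> x; rewrite !comp_lfunE pi tE.
apply/eqP; rewrite -dimv_eq0 -leqn0 -(leq_add2l (\dim U)) addn0.
by rewrite -(dimv_disjoint_sum cUV) sUV.
Qed.

Lemma retract_injective (P Q : rmod A) (s : 'Hom(Q, P)) (r : 'Hom(P, Q)) :
  rhom s -> rhom r -> (forall x, r (s x) = x) -> injective_mod P -> injective_mod Q.
Proof.
move=> hs hr rs hP M N i f hi hf ki.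
have [h hh hE] := hP _ _ i (s \o f)%VF hi (rhom_comp hs hf) ki.
exists (r \o h)%VF; first exact: rhom_comp.
apply/lfunP => x; have /lfunP/(_ x) := hE; rewrite !comp_lfunE => ->.
exact: rs.
Qed.

(** In a basic algebra eA and (1-e)A have no common indecomposable summand. *)
Lemma basic_no_common_summand (e : A) (he : e * e = e) X
    (i : 'Hom(X, eA e)) (p : 'Hom(eA e, X))
    (i' : 'Hom(X, eA (1 - e))) (p' : 'Hom(eA (1 - e), X)) :
  basic_alg A -> indecomposable X -> rhom i -> rhom p -> rhom i' -> rhom p' ->
  (forall x, p (i x) = x) -> (forall x, p' (i' x) = x) -> False.
Proof.
move=> [s [[f [g [hf hg gf fg]]] hs hd]] iX hi hp hi' hp' pi pi'.
have gfE x : g (f x) = x by have /lfunP/(_ x) := gf; rewrite comp_lfunE id_lfunE.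
pose I := (f \o eA_inj e \o i)%VF; pose I' := (f \o eA_inj (1 - e) \o i')%VF.
pose Q := (p \o eA_proj e \o g)%VF; pose Q' := (p' \o eA_proj (1 - e) \o g)%VF.
have hI : rhom I.
  by apply: rhom_comp hi; apply: rhom_comp hf _; apply: eA_inj_rhom.
have hI' : rhom I'.
  by apply: rhom_comp hi'; apply: rhom_comp hf _; apply: eA_inj_rhom.
have hQ : rhom Q.
  by apply: rhom_comp hg; apply: rhom_comp hp _; apply: eA_proj_rhom.
have hQ' : rhom Q'.
  by apply: rhom_comp hg; apply: rhom_comp hp' _; apply: eA_proj_rhom.
have he' := idem_compl he.
have QI : linj (Q \o I)%VF.
  move=> x; rewrite /Q /I !comp_lfunE gfE eA_projK // pi //.
have QI' : linj (Q' \o I')%VF.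
  move=> x; rewrite /Q' /I' !comp_lfunE gfE eA_projK // pi' //.
have h := indec_not_twice iX hs hd hI hI' hQ hQ' QI QI'.
have [[x x0] _] := iX; apply: x0; apply: h.
rewrite /Q /I' !comp_lfunE gfE eA_proj_inj0 ?linear0 //.
by rewrite mul_ee'.
Qed.

(** The right ideal xA. *)
Lemma mem_cyclic (x y : A) :
  reflect (exists b, y = x * b) (y \in (<[x]> * fullv)%VS).
Proof.
apply: (iffP idP) => [h|[b ->]]; last by rewrite memv_mul ?memv_line ?memvf.
suff: y \in limg (amull x).
  by move=> /memv_imgP[b _ ->]; exists b; rewrite lfunE.
move: (y) h; apply/subvP; apply/prodvP => u v /vlineP[c ->] _.
apply/memv_imgP; exists (c *: v); rewrite ?memvf // lfunE /=.
by rewrite -scalerAl scalerAr.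
Qed.

Lemma exists_functional (x : A) : x <> 0 -> exists phi : 'Hom(A, k^o), phi x <> 0.
Proof.
move=> x0; apply: NNPP => h; apply: x0.
rewrite (coord_vbasis (memvf x)) big1 // => i _.
suff -> : coord (vbasis {:A}) i x = 0 by rewrite scale0r.
have hl : linear (coord (vbasis {:A}) i : A -> k^o) by move=> c u v; rewrite linearP.
apply: NNPP => c0; apply: h; exists (mklin hl); by rewrite mklinE.
Qed.

Lemma nakayama_ract X a (phi : nakayama X) :
  ract (nakayama X) a phi = (phi \o lact X a)%VF.
Proof. by have := lfunE (@precomp k _ _ k^o (lact X a)) phi; apply: etrans. Qed.

(** A linear functional phi on A and a map j : M -> A give a map from M to
    D Hom(eA, A), namely y |-> (u |-> phi (j y u(e))). *)
Lemma functional_hom (e : A) (he : e * e = e) M (phi : 'Hom(A, k^o))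
    (j : 'Hom(M, regmod A)) : rhom j ->
  exists2 psi : 'Hom(M, nakayama (eA e)), rhom psi &
  forall y, psi y = 0 -> forall a, phi (j y * a * e) = 0.
Proof.
move=> hj.
have evl : linear (fun u : subvs_of (homA (eA e)) => vsval u (eA_gen e)).
  by move=> c u v; rewrite linearP /= add_lfunE scale_lfunE.
pose ev := mklin evl.
have psil : linear (fun y : M => (phi \o amull (j y) \o ev)%VF
    : 'Hom(subvs_of (homA (eA e)), k^o)).
  move=> c y z; apply/lfunP => u.
  rewrite add_lfunE scale_lfunE !comp_lfunE !lfunE /= !linearP /=.
  by rewrite mulrDl -scalerAl linearP.
pose psi : 'Hom(M, nakayama (eA e)) := mklin psil.
have psiE y u : psi y u = phi (j y * vsval u (eA_gen e)).
  by rewrite [psi y](mklinE psil) !comp_lfunE [ev u]mklinE lfunE.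
exists psi => [a y|y py a].
  apply/lfunP => u; rewrite [LHS]psiE.
  rewrite nakayama_ract comp_lfunE psiE val_lact comp_lfunE lfunE /= hj regmodE.
  by rewrite mulrA.
(* Test on the element u : eA -> A given by left multiplication by a. *)
pose u : 'Hom(eA e, regmod A) := (amull a \o eA_inj e)%VF.
have uE x : u x = a * vsval x by rewrite /u comp_lfunE lfunE /= eA_injE.
have hu : u \in homA (eA e).
  apply/mem_homA => b x; rewrite !uE regmodE rideal_val_ract.
  by rewrite mulrA.
have := psiE y (vsproj _ u); rewrite py lfun0E vsprojK // uE eA_genE //.
by rewrite mulrA.
Qed.

(** The hypothesis of the tilting criterion, by producing from a nonzero map a
    common summand of eA and (1-e)A. *)
Lemma self_injective_vanish (e : A) (he : e * e = e) : basic_alg A ->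
  self_injective A -> riso (eA e) (nakayama (eA e)) ->
  forall f : 'Hom(eA_mod_eAe'A e, eA (1 - e)), rhom f -> f = 0.
Proof.
move=> hb hsi [f0 [g [_ hg _ fg]]] f hf; apply: NNPP => fn0.
have he' := idem_compl he.
pose hU := @eAe'A_in_eA_submodule _ _ e.
pose Q (x : A) := [/\ x <> 0, (1 - e) * x = x & forall a, x * a * (1 - e) = 0].
(* The image x of e under a nonzero map from eA that kills eA(1-e)A. *)
have exQ : exists x, Q x.
  pose F := (f \o quotpi hU)%VF.
  have hF : rhom F by apply: rhom_comp => //; apply: quotpi_rhom.
  exists (vsval (F (eA_gen e))); split.
  - move=> F0; apply: fn0; apply/lfunP => y.
    have /limg_fullP/(_ y)[x <-] := quotpi_surj hU.
    rewrite lfun0E -[LHS]comp_lfunE -/F -(eA_gen_ract he x) hF.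
    by have -> : F (eA_gen e) = 0 by [apply: val_inj]; rewrite ract0.
  - exact: eA_val.
  - move=> a; rewrite -mulrA -rideal_val_ract -hF.
    rewrite -(eA_gen_id he) -ractM /F comp_lfunE.
    suff /eqP -> : quotpi hU (ract (eA e) (e * (a * (1 - e))) (eA_gen e)) == 0.
      by rewrite linear0.
    rewrite -memv_ker quotpi_ker mem_eAe'A rideal_val_ract eA_genE //.
    have := memv_eAe'A e a 1; rewrite mulr1.
    by rewrite !mulrA he.
have [x [xn0 ex xe] xmin] := ex_minimal (fun x => \dim (<[x]> * fullv)%VS) exQ.
have [phi phix] := exists_functional xn0.
have [psi hpsi psi0] := functional_hom he phi (@eA_inj_rhom _ _ (1 - e)).
pose G := (g \o psi)%VF.
have hG : rhom G by apply: rhom_comp.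
have Ginj y : G y = 0 -> psi y = 0.
  rewrite /G comp_lfunE => /(congr1 f0); rewrite linear0 -[f0 _]comp_lfunE fg.
  by rewrite id_lfunE.
clearbody G.
pose j := (eA_proj (1 - e) \o eA_inj x)%VF.
have jE c : vsval (j c) = vsval c.
  rewrite /j comp_lfunE eA_projE eA_injE.
  by have /mem_cyclic[b ->] := subvsP c; rewrite mulrA ex.
have hj : rhom j by apply: rhom_comp; [apply: eA_proj_rhom|apply: eA_inj_rhom].
(* A nonzero c in xA satisfies Q and so generates xA by minimality; thus
   x = c a for some a, and psi c takes the value phi x on left multiplication
   by a. *)
have psij c : psi (j c) = 0 -> c = 0.
  move=> pc; apply: NNPP => c0.
  have /mem_cyclic[b cb] := subvsP c.
  have Qc : Q (vsval c).
    split; first by move=> c0'; apply: c0; apply: val_inj.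
      by rewrite cb mulrA ex.
    by move=> a; rewrite cb -(mulrA x) xe.
  have cx : (<[vsval c]> * fullv)%VS = (<[x]> * fullv)%VS.
    apply/eqP; rewrite eqEdim xmin // andbT.
    apply/subvP => y /mem_cyclic[d ->]; apply/mem_cyclic; exists (b * d).
    by rewrite cb mulrA.
  have : x \in (<[vsval c]> * fullv)%VS.
    by rewrite cx; apply/mem_cyclic; exists 1; rewrite mulr1.
  move=> /mem_cyclic[a xa]; apply: phix.
  have := psi0 _ pc a; rewrite eA_injE jE -xa.
  have -> // : x * e = x.
  by have := xe 1; rewrite mulr1 mulrBr mulr1 => /eqP; rewrite subr_eq0 => /eqP.
have inj_e' : injective_mod (eA (1 - e)).
  apply: (retract_injective (@eA_inj_rhom _ _ (1 - e)) (@eA_proj_rhom _ _ (1 - e))) hsi.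
  exact: eA_projK.
have [|||r hr rE] := inj_e' _ _ (G \o j)%VF j.
- exact: rhom_comp.
- exact: hj.
- by apply/linj_lker => c; rewrite comp_lfunE => /Ginj/psij.
pose th := (r \o G)%VF.
have hth : rhom th by apply: rhom_comp.
have thE y : th y = r (G y) by rewrite /th comp_lfunE.
have thj c : th (j c) = j c.
  by have /lfunP/(_ c) := rE; rewrite !comp_lfunE.
clearbody th.
(* The image of a high power of th is a summand of (1-e)A; it is nonzero since
   th fixes xA, and it is a summand of eA since th factors through eA. *)
have [n hn] := fitting th.
pose q := lpow th n.+1; have hq : rhom q by apply: lpow_rhom.
pose hY := limg_submodule hq.
have qY y : q y \in limg q by rewrite memv_img ?memvf.
pose c : 'Hom(eA (1 - e), submod hY) := corestr hY q.
have hc : rhom c by apply: corestr_rhom.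
have cE y : vsval (c y) = q y by rewrite [LHS]corestrE.
pose io := subin hY; have hio : rhom io by apply: subin_rhom.
have ioE y : io y = vsval y by apply: subinE.
have cio : linj (c \o io)%VF.
  move=> y /(congr1 val); rewrite comp_lfunE [LHS]cE ioE => qy.
  by apply: val_inj; apply: hn; [apply: subvsP|exact: qy].
have [w [hw wc cw]] := linj_endo (rhom_comp hc hio) cio.
have [|X iX [i [p [hi hp pi]]]] := @exists_indec_summand (submod hY).
  pose c0 : eA x := vsproj _ x.
  have c0E : vsval c0 = x.
    by rewrite vsprojK //; apply/mem_cyclic; exists 1; rewrite mulr1.
  exists (c (j c0)) => /(congr1 val); rewrite [LHS]cE /q lpow_fix // => j0.
  by apply: xn0; rewrite -c0E -jE j0.
apply: (@basic_no_common_summand e he X (G \o io \o i)%VF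
  (p \o w \o w \o c \o lpow th n \o r)%VF (io \o i)%VF (p \o w \o c)%VF) => //.
- by apply: rhom_comp => //; apply: rhom_comp.
- have hl := lpow_rhom n hth.
  by do 4 (apply: rhom_comp => //); apply: rhom_comp.
- exact: rhom_comp.
- by apply: rhom_comp => //; apply: rhom_comp.
- move=> y; rewrite !comp_lfunE -thE -lpowSr -/q.
  have -> : q (io (i y)) = io (c (io (i y))) by rewrite [RHS]ioE cE.
  rewrite -[X in w (w X)]comp_lfunE wc -[X in w X]comp_lfunE wc; exact: pi.
by move=> y; rewrite !comp_lfunE -[X in w X]comp_lfunE wc.
Qed.

End SelfInjective.

Theorem theorem2p50 (k : fieldType) (A : falgType k)
    (hbasic : basic_alg A) (hindec : bimod_indecomposable A)
    (e : A) (he : e * e = e) (P : projcover (eAe'A e)) :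
  let T := okuyama_rickard he P in
  let stalk_eA := stalk (peA he) in
  let stalk_e'A := stalk (peA (idem_compl he)) in
  [/\ right_mutation (stalk (pA A)) stalk_eA stalk_e'A T /\
        (forall Y, right_mutation (stalk (pA A)) stalk_eA stalk_e'A Y -> isoT T Y),
      silting T,
      tilting T <->
        (forall f : 'Hom(eA_mod_eAe'A e, eA (1 - e)), rhom f -> f = 0)
    & self_injective A -> riso (eA e) (nakayama (eA e)) -> tilting T].
Proof.
move=> T stalk_eA stalk_e'A.
have mT : right_mutation (stalk (pA A)) stalk_eA stalk_e'A T.
  exact: okuyama_rickard_mutation.
split.
- by split=> // Y mY; apply: right_mutation_unique mT mY.
- exact: okuyama_rickard_silting.
- exact: okuyama_rickard_tilting.
- move=> hsi hnu; apply/okuyama_rickard_tilting.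
  exact: self_injective_vanish.
Qed.
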